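(* Let $w\in\widetilde{\Sigma}_n$ be an affine permutation. Then $$\widetilde{F}_w(x)=\sum_{T} x^T,$$ where the sum is over all column strict balanced labellings $T$ of the diagram $D(w)$, $x^T$ denotes the monomial $\prod_{(i,j)\in[D(w)]}x_{T(i,j)}$, and $\widetilde{F}_w$ is the affine Stanley symmetric function of $w$.
   Context: Let $n\ge 2$. The affine symmetric group $\widetilde{\Sigma}_n$ is the group (under composition) of bijections $w:\mathbb{Z}\to\mathbb{Z}$ with $w(i+n)=w(i)+n$ for all $i$ and $\sum_{i=1}^n w(i)=n(n+1)/2$. It is generated by the simple reflections $s_i$ ($i\in\mathbb{Z}/n\mathbb{Z}$), where $s_i$ interchanges $kn+i$ and $kn+i+1$ for all $k\in\mathbb{Z}$. So $ws_i$ is obtained from the sequence $(w(j))_j$ by switching the entries in positions $i+kn$ and $i+1+kn$ for all $k$. The length $\ell(w)$ is the minimal number of simple reflections in a decomposition of $w$; a decomposition of minimal length gives a reduced word. Affine Stanley symmetric function: a word $a_1\cdots a_\ell$ with letters in $\mathbb{Z}/n\mathbb{Z}$ is cyclically decreasing if each letter appears at most once and, whenever $i$ and $i+1$ both appear, $i+1$ precedes $i$. An affine permutation is cyclically decreasing if it has a cyclically decreasing reduced word (the identity is cyclically decreasing). A cyclically decreasing factorization of $w$ is $w=v_1v_2\cdots v_r$ with each $v_i\in\widetilde{\Sigma}_n$ cyclically decreasing and $\ell(w)=\sum_i\ell(v_i)$. Factors may be the identity, and two factorizations differing only by trailing identity factors are identified (equivalently, use infinite sequences $(v_1,v_2,\dots)$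 with all but finitely many $v_i$ equal to the identity). Then $\widetilde{F}_w(x)=\widetilde F_w(x_1,x_2,\dots)=\sum_{w=v_1v_2\cdots v_r}x_1^{\ell(v_1)}x_2^{\ell(v_2)}\cdots x_r^{\ell(v_r)}$, the sum over all cyclically decreasing factorizations of $w$. Diagrams and labellings: $D(w)=\{(i,w(j)) : i<j,\ w(i)>w(j)\}\subseteq\mathbb{Z}\times\mathbb{Z}$; its elements are called boxes. Coordinates are matrix-like: the first coordinate is the row (increasing southward), the second the column (increasing eastward). $D(w)$ is invariant under translation by $(n,n)$, and $[D(w)]$ is the set of boxes of $D(w)$ in rows $1,\dots,n$. A labelling is a map $T:D(w)\to\mathbb{Z}_{>0}$ with $T(i,j)=T(i+n,j+n)$. The hook $H_{i,j}$ at a box $(i,j)$ (its corner) consists of the boxes $(i',j')$ of $D(w)$ with either $i'=i$, $j'\ge j$, or $i'\ge i$, $j'=j$. A hook is balanced if, after rearranging its labels so that they weakly increase from right to left along its row part and then from top to bottom along its column part, the corner label is unchanged. $T$ is balanced if all hooks are balanced, and column strict if no column contains two equal labels. *)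

(* Defs.v *)
From mathcomp Require Import all_boot all_order all_algebra finmap.
From mathcomp Require Import all_classical.
From mathcomp.multinomials Require Import monalg.

Set Implicit Arguments.
Unset Strict Implicit.
Unset Printing Implicit Defensive.

Import Order.TTheory GRing.Theory Num.Theory.

Local Open Scope classical_set_scope.
Local Open Scope ring_scope.

(* A formal power series over Z in x_1, x_2, ... is the function giving its
   coefficients.  The exponent of x_k in the monomial e is e k; monomials
   involving the index 0 have coefficient 0 in all the series below. *)
Definition monomial : Type := {cmonom nat}.
Definition fps : Type := monomial -> int.

Definition mvar (k : nat) : monomial := ucm k.

Definition fiber (I : Type) (A : set I) (m : I -> monomial)
    (e : monomial) : set I := [set a | A a /\ m a = e].

(* The possibly infinite sum of the monomials m a, for a in A, is well defined
   when each monomial occurs finitely many times. *)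
Definition summable (I : Type) (A : set I) (m : I -> monomial) : Prop :=
  forall e, finite_set (fiber A m e).

(* fset_set returns the empty set on an infinite set, so this is meaningful
   only for summable families. *)
Definition monomial_sum (I : Type) (A : set I) (m : I -> monomial) : fps :=
  fun e => (#|` fset_set (fiber A m e : set {classic I})|)%:Z.

Definition affine_perm (n : nat) (w : int -> int) : Prop :=
  [/\ bijective w,
      forall i : int, w (i + n%:Z) = w i + n%:Z
    & \sum_(1 <= i < n.+1) w i%:Z = ((n * n.+1)./2)%:Z].

(* Z/nZ is 'Z_n, which is correct for n >= 2 only. *)
Definition simple_refl (n : nat) (a : 'Z_n) (x : int) : int :=
  if (x == (a : nat)%:Z %[mod n%:Z])%Z then x + 1
  else if (x == (a : nat)%:Z + 1 %[mod n%:Z])%Z then x - 1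
  else x.

Definition prod_funs (s : seq (int -> int)) : int -> int :=
  foldr (fun f g => f \o g) id s.

Definition word_perm (n : nat) (a : seq 'Z_n) : int -> int :=
  prod_funs (map (@simple_refl n) a).

(* The value is 0 when w is not a product of simple reflections. *)
Definition affine_length (n : nat) (w : int -> int) : nat :=
  xget 0%N [set l | (exists2 a : seq 'Z_n, word_perm a = w & size a = l) /\
                    forall a : seq 'Z_n, word_perm a = w -> (l <= size a)%N].

Definition reduced_word (n : nat) (w : int -> int) (a : seq 'Z_n) : Prop :=
  word_perm a = w /\ size a = affine_length n w.

Definition cyclically_decreasing_word (n : nat) (a : seq 'Z_n) : Prop :=
  uniq a /\ forall i : 'Z_n, i \in a -> i + 1 \in a ->
    (index (i + 1)%R a < index i a)%N.

Definition cyclically_decreasing (n : nat) (v : int -> int) : Prop :=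
  affine_perm n v /\
  exists2 a : seq 'Z_n, reduced_word v a & cyclically_decreasing_word a.

(* Each class of factorizations up to trailing identity factors is represented
   by its unique member without trailing identity factor. *)
Definition cd_factorizations (n : nat) (w : int -> int) :
    set (seq (int -> int)) :=
  [set s | [/\ forall i, (i < size s)%N -> cyclically_decreasing n (nth id s i),
               prod_funs s = w,
               affine_length n w = (\sum_(v <- s) affine_length n v)%N
             & forall s', s <> rcons s' id]].

Definition factorization_monomial (n : nat) (s : seq (int -> int)) : monomial :=
  \big[mmul/mone]_(i < size s)
    expcmn (mvar i.+1) (affine_length n (nth id s i)).

Definition affine_stanley (n : nat) (w : int -> int) : fps :=
  monomial_sum (cd_factorizations n w) (factorization_monomial n).

Definition box : Type := (int * int)%type.

Definition diagram (w : int -> int) : set box :=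
  [set b | exists i j : int, [/\ i < j, w j < w i & b = (i, w j)]].

Definition diagram_rows (n : nat) (w : int -> int) : set box :=
  diagram w `&` [set b | 1 <= b.1 <= n%:Z].

(* A map from D(w) to the positive integers is encoded as a map on all of
   Z x Z that vanishes exactly outside D(w). *)
Definition labelling (n : nat) (w : int -> int) (T : box -> nat) : Prop :=
  (forall b, (0 < T b)%N <-> diagram w b) /\
  forall b, diagram w b -> T b = T (b.1 + n%:Z, b.2 + n%:Z).

Definition hook (w : int -> int) (c : box) : set box :=
  [set b | diagram w b /\
           ((b.1 = c.1 /\ c.2 <= b.2) \/ (c.1 <= b.1 /\ b.2 = c.2))].

(* sigma is the rearrangement: the box b receives the label T (sigma b). *)
Definition balanced_hook (w : int -> int) (T : box -> nat) (c : box) : Prop :=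
  exists sigma : box -> box,
    [/\ set_bij (hook w c) (hook w c) sigma,
        forall b b', hook w c b -> hook w c b' ->
          b.1 = c.1 -> b'.1 = c.1 -> b'.2 <= b.2 ->
          (T (sigma b) <= T (sigma b'))%N,
        forall b b', hook w c b -> hook w c b' ->
          b.2 = c.2 -> b'.2 = c.2 -> b.1 <= b'.1 ->
          (T (sigma b) <= T (sigma b'))%N
      & T (sigma c) = T c].

Definition balanced (w : int -> int) (T : box -> nat) : Prop :=
  forall c, diagram w c -> balanced_hook w T c.

Definition column_strict (w : int -> int) (T : box -> nat) : Prop :=
  forall b b', diagram w b -> diagram w b' -> b.2 = b'.2 -> T b = T b' -> b = b'.

Definition csb_labellings (n : nat) (w : int -> int) : set (box -> nat) :=
  [set T | [/\ labelling n w T, balanced w T & column_strict w T]].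

Definition labelling_monomial (n : nat) (w : int -> int) (T : box -> nat) :
    monomial :=
  \big[mmul/mone]_(b \in diagram_rows n w) mvar (T b).

(* Main.v *)
Require Import Defs.
From mathcomp Require Import all_boot all_order all_algebra.
From mathcomp Require Import finmap all_classical zify.
From mathcomp.multinomials Require Import monalg.

Set Implicit Arguments.
Unset Strict Implicit.
Unset Printing Implicit Defensive.

Import Order.TTheory GRing.Theory Num.Theory.

Local Open Scope classical_set_scope.
Local Open Scope ring_scope.

(** The proof exhibits a bijection between cyclically decreasing factorizations and column
strict balanced labellings that preserves monomials. A box of the diagram in the column a
and in the row where w takes the value b is the same thing as an inversion of w, that is a
pair of values a < b with b standing to the left of a. Multiplying on the right by the
factors of w = v_1 ... v_r creates the inversions of w in stages, and the box of (a, b)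
receives the index k of the factor that inverts the pair. The length of v_k is then the
number of boxes labelled k up to translation, so the monomials agree.

From factorizations to labellings. Lengths add exactly when no inversion is undone
(length_add_inverted), so the boxes with labels at most k are the inversions of
u_k = v_1 ... v_k. Inversion sets are closed: for a < b < c, if (a, b) and (b, c) are
inverted then so is (a, c), and if (a, c) is inverted then so is one of the other two.
This gives balancedness, in the form that among the labels of a hook with corner label C,
the arm labels above C are at most as many as the leg labels below C, and these at most as
many as the arm labels from C on (balanced_hookE, chain_csb). Column strictness expresses
that each factor is cyclically decreasing, because a permutation is cyclically decreasing
when each value is overtaken by at most one larger value (cyclically_decreasingE).

From labellings to factorizations. Suppose that the largest label of a balanced labelling
is M. Some descent w (i + 1) < w i of w has a box labelled M
(max_label_adjacent), and exchanging the positions i and i + 1 removes that box and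
moves the boxes of the two rows. The labels on the remaining boxes are still balanced
(remove_class_csb); the point is that in each column that has a box in both rows the lower
box has the smaller label (max_adjacent_lt). Removing all labels above k in this way
produces the permutation u_k whose inversions are the boxes with labels at most k
(csb_prefix), and the quotients of consecutive u_k are the factors. An affine permutation
is determined by its inversions (inverted_inj), so the two constructions are inverse to
each other. *)

(** * Residues and simple reflections *)

Section Residues.
Variable m : nat.
Local Notation n := m.+2.

Definition residue (x : int) : 'Z_n := x%:~R.

Lemma residueD x y : residue (x + y) = residue x + residue y.
Proof. exact: rmorphD. Qed.

Lemma residueB x y : residue (x - y) = residue x - residue y.
Proof. exact: rmorphB. Qed.

Lemma residueN x : residue (- x) = - residue x.
Proof. exact: rmorphN. Qed.

Lemma residue1 : residue 1 = 1. Proof. by []. Qed.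

Lemma residue_nat (k : nat) : residue k%:Z = k%:R.
Proof. exact: pmulrn. Qed.

Lemma residue_eq0 x : (residue x == 0) = (n%:Z %| x)%Z.
Proof.
have nat_case (k : nat) : (residue k%:Z == 0) = (n %| k)%N.
  by rewrite residue_nat Zp_nat -val_eqE /=.
case: x => k; first by rewrite nat_case dvdzE.
by rewrite NegzE residueN oppr_eq0 nat_case dvdzE abszN.
Qed.

Lemma residue_eq x y : (residue x == residue y) = (x == y %[mod n%:Z])%Z.
Proof. by rewrite eqz_mod_dvd -residue_eq0 residueB subr_eq0. Qed.

Lemma residue_period x : residue (x + n%:Z) = residue x.
Proof.
by rewrite residueD; have /eqP-> : residue n%:Z == 0; rewrite ?addr0// residue_eq0 dvdzz.
Qed.

Lemma residue_shift x k : residue (x + k * n%:Z) = residue x.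
Proof.
rewrite residueD; have /eqP-> : residue (k * n%:Z) == 0; rewrite ?addr0//.
by rewrite residue_eq0 dvdz_mull.
Qed.

Lemma residue_eq_shift x y :
  residue x = residue y -> exists k : int, x = y + k * n%:Z.
Proof.
move/eqP; rewrite residue_eq eqz_mod_dvd => /dvdzP[k e]; exists k.
by rewrite -e addrC subrK.
Qed.

Lemma residueK (a : 'Z_n) : residue (a : nat)%:Z = a.
Proof. by rewrite residue_nat natr_Zp. Qed.

Lemma residue_neq x : residue (x + 1) != residue x.
Proof.
rewrite residueD residue1 -subr_eq0 addrC addKr; exact: oner_neq0.
Qed.

Lemma residue_eq_leq x y : residue x = residue y -> x < y -> x + n%:Z <= y.
Proof.
move/residue_eq_shift => [k ->] lt0.
have k0 : k <= -1.
  by rewrite leNgt; apply/negP => k1; have : 0 <= k * n%:Z; [rewrite mulr_ge0 //|]; lia.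
have : k * n%:Z <= -1 * n%:Z by rewrite ler_wpM2r.
lia.
Qed.

Lemma simple_reflE (a : 'Z_n) x : simple_refl a x =
  if residue x == a then x + 1 else if residue (x - 1) == a then x - 1 else x.
Proof.
rewrite /simple_refl -!residue_eq residueD residueK residue1.
by rewrite residueB residue1 subr_eq.
Qed.

Variant simple_refl_spec (a : 'Z_n) (x : int) : int -> Type :=
| ReflUp of residue x = a & residue (x - 1) != a : simple_refl_spec a x (x + 1)
| ReflDown of residue (x - 1) = a & residue x != a : simple_refl_spec a x (x - 1)
| ReflFix of residue x != a & residue (x - 1) != a : simple_refl_spec a x x.

Lemma simple_reflP a x : simple_refl_spec a x (simple_refl a x).
Proof.
rewrite simple_reflE; have := residue_neq (x - 1); rewrite subrK.
have [<- ne|ne _] := eqVneq (residue x) a.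
  by constructor; rewrite // eq_sym.
by have [e|ne'] := eqVneq (residue (x - 1)) a; constructor.
Qed.

Lemma simple_refl_up x : simple_refl (residue x) x = x + 1.
Proof. by rewrite simple_reflE eqxx. Qed.

Lemma simple_refl_down x : simple_refl (residue x) (x + 1) = x.
Proof.
by rewrite simple_reflE (negPf (residue_neq x)) addrK eqxx.
Qed.

Lemma simple_reflK (a : 'Z_n) : involutive (simple_refl a).
Proof.
move=> x; case: (simple_reflP a x) => [<- _|<- _|ne1 ne2].
- exact: simple_refl_down.
- by rewrite -{1}[x](subrK 1) addrK simple_refl_up subrK.
- by rewrite simple_reflE (negPf ne1) (negPf ne2).
Qed.

Lemma simple_refl_period (a : 'Z_n) x :
  simple_refl a (x + n%:Z) = simple_refl a x + n%:Z.
Proof.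
rewrite !simple_reflE (addrAC x n%:Z (- 1)) !residue_period.
by case: ifP => _; [rewrite addrAC|case: ifP].
Qed.

(** Each integer moves by at most one step, so only neighbours can change their order. *)
Lemma simple_refl_lt (a : 'Z_n) x y : x < y ->
  (simple_refl a x < simple_refl a y) = ~~ ((residue x == a) && (y == x + 1)).
Proof.
move=> xy; have [->|nxy] := eqVneq y (x + 1).
  rewrite andbT; have [<-|nxa] := eqVneq (residue x) a.
    rewrite simple_refl_up simple_refl_down; lia.
  case: (simple_reflP a (x + 1)) => [_ _|e|_ _].
  - case: simple_reflP => [e|_|_]; [by rewrite e eqxx in nxa|lia|lia].
  - by rewrite addrK in e; rewrite e eqxx in nxa.
  - case: simple_reflP => [e|_|_]; [by rewrite e eqxx in nxa|lia|lia].
rewrite andbF /=.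
have ne : simple_refl a x != simple_refl a y.
  by rewrite (inj_eq (inv_inj (@simple_reflK a))); lia.
by case: simple_reflP ne => [_ _|_ _|_ _]; case: simple_reflP => [_ _|_ _|_ _]; lia.
Qed.

End Residues.

(** * Affine permutations and words *)

Definition pos (w : int -> int) (y : int) : int := xget 0 [set x | w x = y].

Lemma posK w : bijective w -> cancel (pos w) w.
Proof.
by case=> g _ gK y; apply: (@xgetPex _ 0 [set x | w x = y]); exists (g y); exact: gK.
Qed.

Lemma permK w : bijective w -> cancel w (pos w).
Proof. by move=> bw x; apply: (bij_inj bw); exact: posK. Qed.

Lemma pos_unique w g : cancel w g -> cancel g w -> pos w = g.
Proof.
move=> wK gK; apply/funext => y.
by apply: (can_inj wK); rewrite gK posK //; exists g.
Qed.

(** Inversions are recorded as pairs of values, because right multiplication by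
a simple reflection then adds or removes one class of pairs and leaves the others
untouched. *)
Definition inverted (w : int -> int) (a b : int) : bool :=
  (a < b) && (pos w b < pos w a).

Lemma inverted_lt w a b : inverted w a b -> a < b.
Proof. by case/andP. Qed.

Lemma inverted_pos w a b : inverted w a b -> pos w b < pos w a.
Proof. by case/andP. Qed.

Lemma pos_inj w : bijective w -> injective (pos w).
Proof. by move=> bw; exact: can_inj (posK bw). Qed.

Section AffinePermutations.
Variable m : nat.
Local Notation n := m.+2.
Implicit Types (w u v f : int -> int) (a b : seq 'Z_n).

Definition equivariant f := forall x : int, f (x + n%:Z) = f x + n%:Z.

Lemma equivariant_shift f x k : equivariant f ->
  f (x + k * n%:Z) = f x + k * n%:Z.
Proof.
move=> ef; have up (j : nat) (y : int) : f (y + j%:Z * n%:Z) = f y + j%:Z * n%:Z.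
  elim: j y => [|j IH] y; first by rewrite !mul0r !addr0.
  by rewrite (intS j) mulrDl mul1r addrA IH ef addrA.
case: (intP k) => [|j|j]; first by rewrite !mul0r !addr0.
  exact: up.
by rewrite !mulNr -{2}[x](subrK (j.+1%:Z * n%:Z)) up addrK.
Qed.

Lemma bij_equivariant_pos w : bijective w -> equivariant w -> equivariant (pos w).
Proof.
by move=> bw ew x; apply: (bij_inj bw); rewrite ew !posK.
Qed.

(** The displacement f x - x depends only on the residue of x. *)
Lemma equivariant_bounded f : equivariant f ->
  exists B : nat, forall x, `|f x - x| <= B%:Z.
Proof.
move=> ef; exists (\sum_(k < n) `|f k%:Z - k%:Z|%N)%N => x.
have -> : f x - x = f (residue m x : nat)%:Z - (residue m x : nat)%:Z.
  have [k e] := residue_eq_shift (esym (residueK (residue m x))).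
  by rewrite {1 2}e equivariant_shift // opprD addrACA subrr addr0.
by rewrite (bigD1 (residue m x)) //= PoszD abszE lerDl.
Qed.

Definition offset w (x : int) : int := \sum_(k < n) (w (x + k%:Z) - (x + k%:Z)).

Lemma offset_const w x y : equivariant w -> offset w x = offset w y.
Proof.
move=> ew; have step (z : int) : offset w (z + 1) = offset w z.
  rewrite /offset big_ord_recr [RHS]big_ord_recl /= addr0 addrC; congr (_ + _).
    rewrite [z + 1 + _](_ : _ = z + n%:Z) ?ew; lia.
  by apply: eq_bigr => i _; rewrite -addrA -intS.
have up (j : nat) (z : int) : offset w (z + j%:Z) = offset w z.
  elim: j z => [|j IH] z; first by rewrite addr0.
  by rewrite (intS j) addrA IH step.
have [xy|xy] := leP x y.
  have -> : y = x + `|y - x|%N%:Z by lia.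
  by rewrite up.
have -> : x = y + `|x - y|%N%:Z by lia.
by rewrite up.
Qed.

Lemma affine_permE w :
  affine_perm n w <-> [/\ bijective w, equivariant w & offset w 1 = 0].
Proof.
suff eq0 : (\sum_(1 <= i < n.+1) w i%:Z = ((n * n.+1)./2)%:Z) <-> (offset w 1 = 0).
  by split=> -[bw ew /eq0].
have -> : offset w 1 = \sum_(1 <= i < n.+1) w i%:Z - ((n * n.+1)./2)%:Z.
  have -> : ((n * n.+1)./2)%:Z = \sum_(1 <= i < n.+1) i%:Z.
    rewrite mulnC -[X in (_ * X)./2]/(n.+1.-1) -bin2 -bin2_sum big_ltn //= add0n.
    by rewrite (big_morph Posz PoszD (erefl _)).
  rewrite -sumrB big_add1 /= big_mkord; apply: eq_bigr => i _.
  by rewrite -intS.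
by split=> [->|/eqP]; rewrite ?subrr // subr_eq0 => /eqP.
Qed.

Lemma affine_bij w : affine_perm n w -> bijective w.
Proof. by case. Qed.

Lemma affine_equivariant w : affine_perm n w -> equivariant w.
Proof. by case. Qed.

Lemma affine_pos_equivariant w : affine_perm n w -> equivariant (pos w).
Proof. by case=> bw ew _; apply: bij_equivariant_pos. Qed.

Lemma affine_offset w x : affine_perm n w -> offset w x = 0.
Proof. by case/affine_permE => _ ew <-; exact: offset_const. Qed.

(** Over the window of length n that starts at a position exchanged with its right
neighbour, the reflection only permutes two terms of the sum. *)
Lemma affine_perm_refl w (i : 'Z_n) :
  affine_perm n w -> affine_perm n (w \o simple_refl i).
Proof.
move=> aw; have [bw ew _] := (affine_permE w).1 aw; apply/affine_permE.
have ews : equivariant (w \o simple_refl i).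
  by move=> x; rewrite /= simple_refl_period ew.
split => //; first exact: bij_comp bw (inv_bij (@simple_reflK m i)).
set z := (i : nat)%:Z; have iz : i = residue m z by rewrite residueK.
rewrite (offset_const 1 z) // -(affine_offset z aw).
rewrite /offset !big_ord_recl /= !addr0 !addrA iz simple_refl_up simple_refl_down.
rewrite -[(bump 0 0)%:Z]/(1 : int); congr (_ + _); first by lia.
apply: eq_bigr => k _; rewrite /bump /= !add1n; congr (w _ - _).
have lek := ltn_ord k; have lt2 : (k.+2 < n)%N by lia.
case: simple_reflP => // [e _|e _]; exfalso.
- by have := residue_eq_leq (esym e); lia.
- by have := residue_eq_leq (esym e); lia.
Qed.

Lemma word_perm_cat a b : word_perm (a ++ b) = word_perm a \o word_perm b.
Proof. by elim: a => //= i a IH; rewrite /word_perm /= in IH *; rewrite IH. Qed.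

Lemma word_perm_rcons a i : word_perm (rcons a i) = word_perm a \o simple_refl i.
Proof. by rewrite -cats1 word_perm_cat. Qed.

Lemma word_permK a : cancel (word_perm a) (word_perm (rev a)).
Proof.
elim: a => // i a IH x; rewrite rev_cons word_perm_rcons.
by rewrite /= simple_reflK; exact: IH.
Qed.

Lemma word_perm_revK a : cancel (word_perm (rev a)) (word_perm a).
Proof. by rewrite -{2}[a]revK; exact: word_permK. Qed.

Lemma pos_word_perm a : pos (word_perm a) = word_perm (rev a).
Proof. exact: pos_unique (@word_permK a) (@word_perm_revK a). Qed.

Lemma affine_perm_id : affine_perm n id.
Proof.
apply/affine_permE; split=> //; first by exists id.
by rewrite /offset big1 // => i _; rewrite subrr.
Qed.

Lemma affine_word_perm a : affine_perm n (word_perm a).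
Proof.
elim/last_ind: a => [|a i IH]; first exact: affine_perm_id.
by rewrite word_perm_rcons; exact: affine_perm_refl.
Qed.

(** An increasing bijection of Z is a translation, and the normalization of the
sum leaves only the identity. *)
Lemma affine_ascending_id w :
  affine_perm n w -> (forall x : int, w x < w (x + 1)) -> w = id.
Proof.
move=> aw inc; have bw := affine_bij aw.
have up (j : nat) (x : int) : w x < w (x + j.+1%:Z).
  elim: j x => [|j IH] x; first exact: inc.
  by rewrite (intS j.+1) addrA; exact: lt_trans (inc x) (IH _).
have mono (x y : int) : x < y -> w x < w y.
  move=> xy; have -> : y = x + (`|y - x|.-1).+1%:Z by lia.
  exact: up.
have succ (x : int) : w (x + 1) = w x + 1.
  have [y e] : exists y, w y = w x + 1 by exists (pos w (w x + 1)); exact: posK.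
  have xy : x < y.
    rewrite ltNge; apply/negP; rewrite le_eqVlt => /orP[/eqP yx|/mono]; last by lia.
    by move: e; rewrite yx; lia.
  have lt := inc x; suff le : w (x + 1) <= w y by lia.
  have [->//|ne] := eqVneq y (x + 1); apply/ltW/mono; lia.
have d (k : nat) : w (0 + k%:Z) - (0 + k%:Z) = w 0.
  elim: k => [|k IH]; first by rewrite !addr0 ?subr0.
  have -> : 0 + k.+1%:Z = 0 + k%:Z + 1 by lia.
  by rewrite succ; lia.
have w0 : w 0 = 0.
  have := affine_offset 0 aw; rewrite /offset (eq_bigr (fun=> w 0)) => [|k _]; last exact: d.
  by rewrite sumr_const card_ord => /eqP; rewrite mulrn_eq0 => /eqP.
have dn (k : nat) : w (- k%:Z) = - k%:Z.
  elim: k => [|k IH]; first by rewrite oppr0 w0.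
  have := succ (- k.+1%:Z); have -> : - k.+1%:Z + 1 = - k%:Z by lia.
  rewrite IH; lia.
apply/funext => x; case: (intP x) => [|k|k]; [exact: w0| |by rewrite dn].
have := d k.+1; rewrite w0 !add0r => /eqP; rewrite subr_eq0 => /eqP; exact.
Qed.

Lemma affine_descent w : affine_perm n w -> w <> id -> exists x : int, w (x + 1) < w x.
Proof.
move=> aw nid; apply: contrapT => nd; apply: nid; apply: affine_ascending_id => // x.
rewrite ltNge; apply/negP; rewrite le_eqVlt => /orP[/eqP/(bij_inj (affine_bij aw))|lt].
  lia.
by apply: nd; exists x.
Qed.

End AffinePermutations.

(** * Length and inversions *)

Section Length.
Variable m : nat.
Local Notation n := m.+2.
Implicit Types (w u v : int -> int) (x y z : int).

Lemma pos_comp u v : bijective u -> bijective v -> pos (u \o v) = pos v \o pos u.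
Proof.
move=> bu bv; apply: pos_unique => x /=; first by rewrite !permK.
by rewrite !posK.
Qed.

Lemma simple_refl_bij (i : 'Z_n) : bijective (simple_refl i).
Proof. exact: inv_bij (@simple_reflK m i). Qed.

Lemma pos_comp_refl w (i : 'Z_n) :
  bijective w -> pos (w \o simple_refl i) = simple_refl i \o pos w.
Proof.
move=> bw; rewrite pos_comp //; last exact: simple_refl_bij.
by congr (_ \o _); apply: pos_unique; exact: simple_reflK.
Qed.

Lemma ascent_shift w x y : affine_perm n w -> residue m y = residue m x ->
  exists k : int, w y = w x + k * n%:Z /\ w (y + 1) = w (x + 1) + k * n%:Z.
Proof.
move=> aw /residue_eq_shift[k ->]; exists k.
by rewrite -!(equivariant_shift _ _ (affine_equivariant aw)) addrAC.
Qed.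

Lemma inverted_refl w x (a b : int) : affine_perm n w -> w x < w (x + 1) ->
  inverted (w \o simple_refl (residue m x)) a b =
  inverted w a b ||
  (residue m (pos w a) == residue m x) && (pos w b == pos w a + 1).
Proof.
move=> aw lt; have bw := affine_bij aw; rewrite /inverted pos_comp_refl //=.
set i := residue m x; have up y : residue m y = i -> w y < w (y + 1).
  by move/(ascent_shift aw) => [k [-> ->]]; rewrite ltrD2r.
have [ab|ba|->] := ltgtP a b; last by rewrite ltxx andbC; case: eqVneq => //; lia.
- case: (ltgtP (pos w a) (pos w b)) => [pab|pba|/(pos_inj bw)]; last by lia.
    rewrite orFb -[RHS]negbK -(simple_refl_lt i pab) -leNgt [RHS]le_eqVlt.
    rewrite (inj_eq (inv_inj (@simple_reflK m i))).
    by rewrite (_ : (pos w b == pos w a) = false) //; lia.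
  have := simple_refl_lt i pba => ->; rewrite orTb; apply/negP => /andP[/eqP e /eqP e'].
  by have := up _ e; rewrite -e' !posK //; lia.
- rewrite orFb; apply/esym/negP => /andP[/eqP e /eqP e'].
  by have := up _ e; rewrite -e' !posK //; lia.
Qed.

Lemma inverted_shift w a b k : affine_perm n w ->
  inverted w (a + k * n%:Z) (b + k * n%:Z) = inverted w a b.
Proof.
move=> aw; rewrite /inverted !(equivariant_shift _ _ (affine_pos_equivariant aw)).
by rewrite !ltrD2r.
Qed.

Lemma inverted_bound w : affine_perm n w ->
  exists K : nat, forall a b, inverted w a b -> b < a + K%:Z.
Proof.
move=> aw; have [B bB] := equivariant_bounded (affine_pos_equivariant aw).
exists (B + B)%N => a b /andP[_ lt]; have := bB a; have := bB b; lia.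
Qed.

Lemma finite_square (B : nat) :
  finite_set [set p : int * int | `|p.1| <= B%:Z /\ `|p.2| <= B%:Z].
Proof.
have fin : finite_set [set x : int | `|x| <= B%:Z].
  apply: (sub_finite_set _ (finite_seq [seq k%:Z - B%:Z | k <- iota 0 (B + B).+1])).
  move=> x; rewrite /mkset => lex; apply/mapP; exists (absz (x + B%:Z)); last by lia.
  by rewrite mem_iota; lia.
by apply: (sub_finite_set _ (finite_setX fin fin)) => -[x y].
Qed.

Lemma window_shift z : exists k : int, 1 <= z + k * n%:Z <= n%:Z.
Proof.
exists (- ((z - 1) %/ n%:Z)%Z).
have := divz_eq (z - 1) n%:Z; have := @ltz_pmod (z - 1) n%:Z isT.
have := @modz_ge0 (z - 1) n%:Z isT.
set q := (_ %/ _)%Z; set r := (_ %% _)%Z; rewrite mulNr.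
move: (q * n%:Z) => t; lia.
Qed.

Lemma window_unique z k : 1 <= z <= n%:Z -> 1 <= z + k * n%:Z <= n%:Z -> k = 0.
Proof.
move=> w1 w2; have [lt|gt|e] := ltgtP (z + k * n%:Z) z.
- by have := residue_eq_leq (residue_shift m z k) lt; lia.
- by have := residue_eq_leq (esym (residue_shift m z k)) gt; lia.
- have /eqP : k * n%:Z = 0 by lia.
  by rewrite mulf_eq0 orbF => /eqP.
Qed.

(** The window condition on phi chooses one inversion in each translation class;
leaving phi arbitrary lets one count inversions by values or by positions of
a fixed permutation, with the same result. *)
Definition inversions (phi : int -> int) w : set (int * int) :=
  [set p | inverted w p.1 p.2 /\ 1 <= phi p.2 <= n%:Z].

Definition inv_number phi w : nat := #|` fset_set (inversions phi w)|.

Lemma window_finite phi w (S : set (int * int)) :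
  equivariant m phi -> affine_perm n w ->
  S `<=` inversions phi w -> finite_set S.
Proof.
move=> ephi aw; have [B bB] := equivariant_bounded ephi.
have [K bK] := inverted_bound aw => sub.
apply: (sub_finite_set _ (finite_square (B + n + K)%N)) => -[a b] /sub[/= ib wb].
have := bB b; have := bK _ _ ib; have := inverted_lt ib.
lia.
Qed.

Section Count.
Variable phi : int -> int.
Hypothesis ephi : equivariant m phi.

Lemma inversions_finite w : affine_perm n w -> finite_set (inversions phi w).
Proof. by move=> aw; apply: (window_finite ephi aw). Qed.

Lemma inv_number_ascent w x : affine_perm n w -> w x < w (x + 1) ->
  inv_number phi (w \o simple_refl (residue m x)) = (inv_number phi w).+1.
Proof.
move=> aw lt; have bw := affine_bij aw; have ew := affine_equivariant aw.
have [k wk] := window_shift (phi (w (x + 1))).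
pose p0 := (w (x + k * n%:Z), w (x + k * n%:Z + 1)).
have p0E : p0.2 = w (x + 1) + k * n%:Z.
  by rewrite /p0 /= addrAC equivariant_shift.
rewrite /inv_number.
have -> : inversions phi (w \o simple_refl (residue m x)) = p0 |` inversions phi w.
  apply/seteqP; split=> -[a b] /=; rewrite /inversions /= inverted_refl //.
    case=> /orP[ib|/andP[/eqP e /eqP e']] wb; [by right|left].
    have [k' ek'] := residue_eq_shift e.
    have ae : a = w (x + k' * n%:Z) by rewrite -ek' posK.
    have be : b = w (x + k' * n%:Z + 1) by rewrite -ek' -e' posK.
    suff kk : k' - k = 0 by rewrite /p0 ae be (_ : k' = k) //; lia.
    apply: (window_unique wk); rewrite mulrBl addrA addrAC addrK.
    move: wb; rewrite be addrAC (equivariant_shift _ _ ew).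
    by rewrite equivariant_shift.
  case=> [[-> ->]|[-> ?]]; last by [].
  rewrite !permK // residue_shift !eqxx orbT; split=> //.
  by move: p0E => /= ->; rewrite equivariant_shift.
rewrite fset_setU1; last exact: inversions_finite.
suff out : ~ inversions phi w p0.
  by rewrite cardfsU1 in_fset_set ?(memNset out) //; exact: inversions_finite.
by case=> /inverted_pos; rewrite /= !permK //; lia.
Qed.

Lemma inv_number_descent w x : affine_perm n w -> w (x + 1) < w x ->
  inv_number phi w = (inv_number phi (w \o simple_refl (residue m x))).+1.
Proof.
move=> aw lt; have aw' := affine_perm_refl (residue m x) aw.
rewrite -(inv_number_ascent (x := x) aw').
  by congr inv_number; apply/funext => y /=; rewrite simple_reflK.
by rewrite /= simple_refl_up simple_refl_down.
Qed.

Lemma residue_dec w (i : 'Z_n) : affine_perm n w ->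
  exists x, residue m x = i /\ (w x < w (x + 1) \/ w (x + 1) < w x).
Proof.
move=> aw; exists (i : nat)%:Z; split; first exact: residueK.
case: ltgtP => [||/(bij_inj (affine_bij aw))]; [by left|by right|lia].
Qed.

Lemma inv_number_word (a : seq 'Z_n) : (inv_number phi (word_perm a) <= size a)%N.
Proof.
elim/last_ind: a => [|a i IH].
  rewrite /inv_number (_ : inversions phi _ = set0) ?fset_set0 //.
  apply/seteqP; split=> // -[a b] [/andP[/= ab]]; rewrite (@pos_unique id id) //; lia.
rewrite word_perm_rcons size_rcons; have aw := affine_word_perm a.
have [x [<- [lt|lt]]] := residue_dec i aw; first by rewrite inv_number_ascent.
by have := inv_number_descent aw lt; move: IH; lia.
Qed.

(** Stripping a descent removes one inversion class, and a permutation without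
descents is the identity. *)
Lemma exists_word w : affine_perm n w ->
  exists2 a : seq 'Z_n, word_perm a = w & size a = inv_number phi w.
Proof.
have [k] := ubnP (inv_number phi w); elim: k w => // k IH w lek aw.
have [->|nid] := pselect (w = id).
  exists [::] => //; apply/eqP; rewrite eq_sym -leqn0; exact: (inv_number_word [::]).
have [x lt] := affine_descent aw nid.
have e := inv_number_descent aw lt.
have [|a ea sa] := IH _ _ (affine_perm_refl (residue m x) aw); first by lia.
exists (rcons a (residue m x)); last by rewrite size_rcons sa e.
by rewrite word_perm_rcons ea; apply/funext => y /=; rewrite simple_reflK.
Qed.

Lemma affine_lengthE w : affine_perm n w -> affine_length n w = inv_number phi w.
Proof.
move=> aw; have [a ea sa] := exists_word aw; apply: xget_unique.
  split; first by exists a.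
  by move=> b <-; exact: inv_number_word.
move=> l [[b eb sb] lmin]; apply/eqP; rewrite eqn_leq -{1}sa lmin //=.
by rewrite -eb -sb inv_number_word.
Qed.

End Count.

Lemma affine_perm_comp u v : affine_perm n u -> affine_perm n v -> affine_perm n (u \o v).
Proof.
have e0 : equivariant m id by [].
by move=> /(exists_word e0)[a <- _] /(exists_word e0)[b <- _];
  rewrite -word_perm_cat; exact: affine_word_perm.
Qed.

Lemma affine_perm_pos u : affine_perm n u -> affine_perm n (pos u).
Proof.
have e0 : equivariant m id by [].
by move=> /(exists_word e0)[a <- _]; rewrite pos_word_perm; exact: affine_word_perm.
Qed.

Lemma affine_length_descent w x : affine_perm n w -> w (x + 1) < w x ->
  affine_length n w = (affine_length n (w \o simple_refl (residue m x))).+1.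
Proof.
have e0 : equivariant m id by [].
move=> aw lt; rewrite (affine_lengthE e0) // (inv_number_descent e0 aw lt).
by rewrite -(affine_lengthE e0) //; exact: affine_perm_refl.
Qed.

Lemma affine_length_id : affine_length n id = 0%N.
Proof.
have e0 : equivariant m id by [].
rewrite (affine_lengthE e0); last exact: affine_perm_id.
by apply/eqP; rewrite -leqn0; exact: (inv_number_word e0 [::]).
Qed.

Lemma affine_length_comp u v : affine_perm n u -> affine_perm n v ->
  (affine_length n (u \o v) <= affine_length n u + affine_length n v)%N.
Proof.
have e0 : equivariant m id by [].
move=> au av; have [a ea sa] := exists_word e0 au.
have [b eb sb] := exists_word e0 av.
have auv : affine_perm n (u \o v).
  by rewrite -ea -eb -word_perm_cat; exact: affine_word_perm.
rewrite !(affine_lengthE e0) // -sa -sb -size_cat.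
by rewrite -ea -eb -word_perm_cat inv_number_word.
Qed.

(** Permutations with the same inversions order all values alike, so one is
the other followed by an increasing permutation of the positions. *)
Lemma inverted_inj u v : affine_perm n u -> affine_perm n v ->
  (forall a b, inverted u a b = inverted v a b) -> u = v.
Proof.
move=> au av same; have bu := affine_bij au; have bv := affine_bij av.
have id' : pos u \o v = id.
  apply: (@affine_ascending_id m).
    by apply: affine_perm_comp => //; exact: affine_perm_pos.
  move=> x /=; rewrite lt_neqAle (inj_eq (pos_inj bu)) (inj_eq (bij_inj bv)).
  rewrite leNgt; have [lt|gt|e] := ltgtP (v x) (v (x + 1)).
  - by have := same (v x) (v (x + 1)); rewrite /inverted lt !permK //; lia.
  - by have := same (v (x + 1)) (v x); rewrite /inverted gt !permK //; lia.
  - by move: e => /(bij_inj bv); lia.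
by apply/funext => x; rewrite -[v x](posK bu) -[pos u (v x)]/((pos u \o v) x) id'.
Qed.

(** Along a reduced word of v, each letter multiplied to u on the right either
creates a class of inversions or undoes one; lengths add when every letter creates.
A pair undone by v would be inverted in u and not in u v. *)
Lemma length_add_inverted u v : affine_perm n u -> affine_perm n v ->
  affine_length n (u \o v) = (affine_length n u + affine_length n v)%N <->
  (forall a b, inverted u a b -> inverted (u \o v) a b).
Proof.
move=> au; have [k] := ubnP (affine_length n v); elim: k v => // k IH v lek av.
have [->|nid] := pselect (v = id); first by rewrite affine_length_id addn0.
have [x lt] := affine_descent av nid; set i := residue m x.
have lv : affine_length n v = (affine_length n (v \o simple_refl i)).+1 :=
  affine_length_descent av lt.
have av' := affine_perm_refl i av; have auv := affine_perm_comp au av.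
have auv' := affine_perm_comp au av'.
have bu := affine_bij au; have bv := affine_bij av.
have [] := IH (v \o simple_refl i); [by rewrite -ltnS -lv|by []|].
move=> IH1 IH2; have ee : u \o v = (u \o (v \o simple_refl i)) \o simple_refl i.
  by apply/funext => y /=; rewrite simple_reflK.
have bv' := affine_bij av'.
have ne : u (v (x + 1)) <> u (v x) by move=> /(bij_inj bu) /(bij_inj bv); lia.
have [up|dn|//] := ltgtP (u (v (x + 1))) (u (v x)).
  have lt' : (u \o (v \o simple_refl i)) x < (u \o (v \o simple_refl i)) (x + 1).
    by rewrite /= simple_refl_up simple_refl_down.
  have luv : affine_length n (u \o v) =
      (affine_length n (u \o (v \o simple_refl i))).+1 := affine_length_descent auv up.
  split=> [e a b ib|mono].
    rewrite ee inverted_refl //; apply/orP; left; apply: IH1 => //.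
    by move: e; rewrite luv lv; lia.
  rewrite luv lv addnS IH2 // => a b ib; move: (mono a b ib).
  rewrite ee inverted_refl // => /orP[//|/andP[/eqP]].
  set y := pos _ a => ey /eqP ey1; have := inverted_pos ib.
  have ea : a = u (v (y + 1)).
    by rewrite -[a](posK (affine_bij auv')) -/y /= /i -ey simple_refl_up.
  have eb : b = u (v y).
    rewrite -[b](posK (affine_bij auv')).
    by rewrite ey1 /= /i -ey simple_refl_down.
  rewrite ea eb !permK //; have [k' [-> ->]] := ascent_shift av ey; lia.
split=> [e|mono].
  have := affine_length_comp au av'.
  have := @affine_length_descent (u \o (v \o simple_refl i)) x auv'.
  rewrite /= simple_refl_up simple_refl_down -/i => /(_ dn).
  by rewrite -ee; lia.
have /mono : inverted u (u (v x)) (u (v (x + 1))) by rewrite /inverted dn !permK.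
move/inverted_pos.
rewrite -[u (v x)]/((u \o v) x) -[u (v (x + 1))]/((u \o v) (x + 1)).
by rewrite !(permK (affine_bij auv)); lia.
Qed.

End Length.

(** * Cyclically decreasing permutations *)

Section CyclicallyDecreasing.
Variable m : nat.
Local Notation n := m.+2.
Implicit Types (v : int -> int) (a : seq 'Z_n) (i j : 'Z_n) (x y z : int).

(** This property is equivalent to being cyclically decreasing: a cyclically
decreasing word acts on disjoint intervals of positions, in each of which the last
value jumps to the front, so that every other value is overtaken once. *)
Definition single_jump v := forall x y1 y2 : int,
  y1 < x -> y2 < x -> v x < v y1 -> v x < v y2 -> y1 = y2.

Lemma simple_refl_fix_lt i x y :
  residue m x != i -> residue m (x - 1) != i -> y < x -> simple_refl i y < x.
Proof.
move=> ne1 ne2 yx; have := simple_refl_lt i yx.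
rewrite [simple_refl i x]simple_reflE (negPf ne1) (negPf ne2) => ->.
by apply: contra ne2 => /andP[/eqP <- /eqP ->]; rewrite addrK.
Qed.

Lemma Zp_succ_neq i : i + 1 != i.
Proof. by have := @residue_neq m (i : nat)%:Z; rewrite residueD residueK. Qed.

Lemma cyclically_decreasing_rcons a i : cyclically_decreasing_word (rcons a i) <->
  [/\ cyclically_decreasing_word a, i \notin a & i - 1 \notin a].
Proof.
have idx j : j \in a -> index j (rcons a i) = index j a.
  by move=> ja; rewrite -cats1 index_cat ja.
have idx0 : i \notin a -> index i (rcons a i) = size a.
  by move=> ia; rewrite -cats1 index_cat (negPf ia) /= eqxx addn0.
rewrite /cyclically_decreasing_word rcons_uniq; split.
- case=> /andP[ia ua] dec; split=> //.
    split=> // j ja ja1; rewrite -(idx j) // -(idx (j + 1)) //.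
    by apply: dec; rewrite mem_rcons inE ?ja ?ja1 orbT.
  apply/negP => ja; have := dec (i - 1); rewrite !mem_rcons !inE subrK eqxx ja orbT.
  by rewrite idx0 // idx // => /(_ isT isT); rewrite ltnNge index_size.
- case=> -[ua dec] ia ja; rewrite ia ua; split=> // j; rewrite !mem_rcons !inE.
  have [-> _|ne /= jina] := eqVneq j i.
    rewrite (negPf (Zp_succ_neq i)) /= => i1a.
    by rewrite idx0 // idx // index_mem.
  have [e|ne' /= j1a] := eqVneq (j + 1) i.
    by rewrite -e addrK jina in ja.
  by rewrite !idx //; exact: dec.
Qed.

(** Only the letter of the residue of x carries a value across the cut between x and x + 1. *)
Lemma word_perm_cut a x z : residue m x \notin a -> (word_perm a z <= x) = (z <= x).
Proof.
elim: a => // i a IH; rewrite inE negb_or => /andP[ne /IH <-] /=.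
rewrite /word_perm /= -/(word_perm a z); case: simple_reflP => // [e _|e _].
- have : word_perm a z != x by apply: contraNneq ne => <-; rewrite e.
  lia.
- have : word_perm a z - 1 != x by apply: contraNneq ne => <-; rewrite e.
  lia.
Qed.

(** Neither i nor i - 1 occurs before a last letter i. Hence the prefix
respects the cuts on both sides of i and fixes i. *)
Lemma cyclically_decreasing_single_jump a :
  cyclically_decreasing_word a -> single_jump (word_perm a).
Proof.
elim/last_ind: a => [_|a i IH]; first by move=> x y1 y2 /=; rewrite /word_perm /=; lia.
case/cyclically_decreasing_rcons => /IH {}IH ia ja; rewrite word_perm_rcons.
set v := word_perm a in IH *.
have cut x z : residue m x = i -> (v z <= x) = (z <= x).
  by move=> ex; apply: word_perm_cut; rewrite ex.
have cut' x z : residue m x = i -> (v z < x) = (z < x).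
  move=> ex; rewrite -!lezD1 -!lerBrDr; apply: word_perm_cut.
  by rewrite residueB ex.
have bij : injective (simple_refl i) := inv_inj (@simple_reflK m i).
move=> x y1 y2 lt1 lt2 /=.
have [e _|e _|ne1 ne2] := simple_reflP i x.
- (* the value now at x came from x + 1, beyond the cut *)
  have lt y : y < x -> v (simple_refl i y) < v (x + 1) => [yx|].
    have : v (simple_refl i y) < x.
      rewrite cut' //; case: simple_reflP => [ey _|_ _|_ _]; try lia.
      by have := residue_eq_leq (etrans ey (esym e)) yx; lia.
    have : ~~ (v (x + 1) <= x) by rewrite cut //; lia.
    lia.
  by have := lt _ lt1; lia.
- (* the value now at x is x - 1, and only x - 1 holds a larger one before x *)
  have vx : v (x - 1) = x - 1.
    by have := cut (x - 1) (x - 1) e; have := cut' (x - 1) (x - 1) e; lia.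
  have small y : y < x -> v (x - 1) < v (simple_refl i y) -> y = x - 1.
    move=> yx; rewrite vx => lt; apply: contrapT => ne.
    have : ~~ (v (simple_refl i y) < x - 1) by lia.
    rewrite cut' // => /negP[]; have yx1 : y < x - 1 by lia.
    case: simple_reflP => [ey _|_ _|_ _]; try lia.
    by have := residue_eq_leq (etrans ey (esym e)) yx1; lia.
  by move=> /(small _ lt1) -> /(small _ lt2) ->.
- by move=> l1 l2; apply: bij; apply: IH l1 l2; exact: simple_refl_fix_lt.
Qed.

(** Any descent can be stripped: the remaining permutation still jumps at most
once over each value. The last clause is the invariant that makes the word
cyclically decreasing: at a descent i the shorter permutation has no larger value to
the left of i or i + 1, so its word contains neither i - 1 nor i. *)
Lemma single_jump_word v : affine_perm n v -> single_jump v ->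
  exists a, [/\ word_perm a = v, size a = affine_length n v,
    cyclically_decreasing_word a &
    forall y, residue m y \in a -> exists2 z, z <= y & v (y + 1) < v z].
Proof.
have [k] := ubnP (affine_length n v); elim: k v => // k IH v lek av sv.
have [->|nid] := pselect (v = id).
  by exists [::]; rewrite affine_length_id.
have [x lt] := affine_descent av nid; set i := residue m x.
have lv : affine_length n v = (affine_length n (v \o simple_refl i)).+1 :=
  affine_length_descent av lt.
have bij : injective (simple_refl i) := inv_inj (@simple_reflK m i).
have dn y : residue m y = i -> v (y + 1) < v y.
  by move/(ascent_shift av) => [k' [-> ->]]; rewrite ltrD2r.
have low y z : residue m y = i -> z < y -> v (simple_refl i z) <= v (y + 1).
  move=> ey zy; rewrite leNgt; apply/negP => l.
  have sz : simple_refl i z < y + 1 by case: simple_reflP; lia.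
  have e := sv (y + 1) y (simple_refl i z) _ sz (dn _ ey) l.
  have : simple_refl i y = z by rewrite e ?simple_reflK; lia.
  by rewrite -ey simple_refl_up; lia.
pose v' := v \o simple_refl i.
have sv' : single_jump v'.
  move=> t y1 y2 lt1 lt2; rewrite /v' /=.
  have [e _|e _|ne1 ne2] := simple_reflP i t.
  - by have := low _ _ e lt1; lia.
  - suff : v (simple_refl i y1) <= v (t - 1) by lia.
    have := dn _ e; have := low _ y1 e; rewrite subrK.
    have [-> _|ne] := eqVneq y1 (t - 1); last by lia.
    by rewrite -e simple_refl_up subrK; lia.
  - move=> l1 l2; apply: bij; apply: sv l1 l2; exact: simple_refl_fix_lt.
have [|a [ea sa ca la]] := IH v' _ (affine_perm_refl i av) sv'; first by rewrite /v'; lia.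
have ia : i \notin a.
  apply/negP => /la[z]; rewrite /v' /= simple_refl_down => zx.
  have := low x z erefl; have [->|ne] := eqVneq z x; last by lia.
  by rewrite /i simple_refl_up; lia.
have ja : i - 1 \notin a.
  apply/negP; rewrite /i -residue1 -residueB => /la[z zx].
  rewrite /v' /= subrK /i simple_refl_up -/i.
  by have := low x z erefl; lia.
exists (rcons a i); split.
- by rewrite word_perm_rcons ea; apply/funext => y; rewrite /v' /= simple_reflK.
- by rewrite size_rcons sa lv.
- exact/cyclically_decreasing_rcons.
- move=> y; rewrite mem_rcons inE => /orP[/eqP/dn|ya]; first by exists y.
  have ne1 : residue m (y + 1) != i.
    by apply: contraNneq ja => <-; rewrite residueD addrK.
  have ne2 : residue m (y + 1 - 1) != i by rewrite addrK; apply: contraNneq ia => <-.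
  have [z zy] := la _ ya; rewrite /v' /= [simple_refl i (y + 1)]simple_reflE.
  rewrite (negPf ne1) (negPf ne2); exists (simple_refl i z) => //.
  by rewrite -ltzD1; apply: simple_refl_fix_lt; rewrite ?ltzD1.
Qed.

Lemma cyclically_decreasingE v : affine_perm n v ->
  cyclically_decreasing n v <-> single_jump v.
Proof.
move=> av; split=> [[_ [a [<- _] ca]]|sv]; first exact: cyclically_decreasing_single_jump.
by have [a [ea sa ca _]] := single_jump_word av sv; split=> //; exists a.
Qed.

End CyclicallyDecreasing.

(** * Labellings indexed by pairs of values *)

Lemma count_D1 (T : eqType) (p : pred T) (s : seq T) x : uniq s -> x \in s ->
  count p s = (p x + count (fun y => (y != x) && p y) s)%N.
Proof.
elim: s => // y s IH /= /andP[ys us]; rewrite inE => /orP[/eqP xy|xs].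
  rewrite xy eqxx; congr (_ + _)%N; apply: eq_in_count => z zs.
  by have -> : z != y by apply: contraNneq ys => <-.
have -> /= : y != x by apply: contraNneq ys => ->.
by rewrite IH // addnCA.
Qed.

Lemma count_eq0P (T : eqType) (p : pred T) (s : seq T) :
  (forall x, ~~ p x) -> count p s = 0%N.
Proof. by move=> np; apply/eqP; rewrite -leqn0 leqNgt -has_count; apply/hasPn. Qed.

Section BalancedCounts.
Variable m : nat.
Local Notation n := m.+2.
Implicit Types (w : int -> int) (L : int -> int -> nat) (K : nat).

(** The three counts compare the hook at the column a and the row of the value c with
its corner label L a c. The offset d = 0 stands for the corner itself, which is
excluded by strictness in arm_above and in leg_below but not in arm_from. *)
Definition arm_above K L (a c : int) : nat :=
  count (fun d : nat => L a c < L (a + d%:Z)%R c)%N (iota 0 K).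

Definition arm_from K L (a c : int) : nat :=
  count (fun d : nat => (0 < d) && (L a c <= L (a + d%:Z)%R c))%N (iota 0 K).

Definition leg_below K w L (a c : int) : nat :=
  count (fun d : nat => (pos w c < pos w (a + d%:Z)) &&
                        (0 < L a (a + d%:Z)%R < L a c)%N) (iota 0 K).

(** Column strict balanced labellings, with L a b the label of the box in the column a
and in the row where w takes the value b. This indexing does not change when boxes
are moved by a simple reflection of the rows. The bound K makes the counts over
the offsets d < K range over whole hooks. *)
Record csb_values K w L : Prop := CsbValues {
  csb_bound : forall a b, inverted w a b -> b < a + K%:Z;
  csb_supp : forall a b, (0 < L a b)%N = inverted w a b;
  csb_period : forall a b : int, L (a + n%:Z) (b + n%:Z) = L a b;
  csb_strict : forall a b c, (0 < L a b)%N -> L a b = L a c -> b = c;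
  csb_balanced : forall a c, inverted w a c ->
    (arm_above K L a c <= leg_below K w L a c <= arm_from K L a c)%N }.

Lemma csb_shift K w L a b k : csb_values K w L ->
  L (a + k * n%:Z) (b + k * n%:Z) = L a b.
Proof.
move=> cL; pose f x : int := x + (L x (x + (b - a)))%:Z.
have ef : equivariant m f.
  move=> x; rewrite /f -(csb_period cL x) (addrAC x (b - a) n%:Z).
  exact: addrAC.
have := equivariant_shift a k ef; rewrite /f [RHS]addrAC => /addrI.
by rewrite (addrAC a) !(addrC a (b - a)) !subrK => -[].
Qed.

Lemma inverted_offset K w L a b : csb_values K w L -> inverted w a b ->
  exists2 d : nat, d \in iota 0 K & b = a + d%:Z.
Proof.
move=> cL ib; have := csb_bound cL ib; have := inverted_lt ib => l1 l2.
by exists (absz (b - a)); [rewrite mem_iota|]; lia.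
Qed.

(** There are finitely many boxes up to translation. *)
Lemma csb_labels_bounded K w L : csb_values K w L ->
  exists B : nat, forall a b, (L a b <= B)%N.
Proof.
move=> cL; exists (\sum_(r < n) \sum_(d < K) L (r : nat)%:Z ((r : nat)%:Z + (d : nat)%:Z)%R)%N.
move=> a b; case: (posnP (L a b)) => [->//|]; rewrite (csb_supp cL) => ib.
have [k ek] := residue_eq_shift (esym (residueK (residue m a))).
have [d dK eb] := inverted_offset cL ib; rewrite mem_iota /= in dK.
rewrite (bigD1 (residue m a)) //= (bigD1 (Ordinal dK)) //=.
rewrite (_ : L a b = L (residue m a : nat)%:Z ((residue m a : nat)%:Z + d%:Z)) -?addnA ?leq_addr //.
by rewrite -[RHS](csb_shift _ _ k cL) addrAC -ek eb.
Qed.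

Lemma csb_least_bound K w L : csb_values K w L ->
  exists2 M, (forall a b, L a b <= M)%N &
    forall M', (forall a b, L a b <= M')%N -> (M <= M')%N.
Proof.
move=> cL; have ex : exists M, `[< forall a b, (L a b <= M)%N >].
  by have [B bB] := csb_labels_bounded cL; exists B; apply/asboolP.
case: (ex_minnP ex) => M /asboolP maxM Mmin; exists M => // M' b.
by apply: Mmin; exact/asboolP.
Qed.

(** Take the rightmost box of a row with the maximal label M. No box of its arm reaches
M, so balancedness leaves no smaller label in its leg, and the leg is empty. Hence the
next position i + 1 of w also holds a smaller value than w i; the box in that column has
an empty leg too and has M in its arm or at its corner, so it carries M. *)
Lemma max_label_adjacent K w L M x y : affine_perm n w -> csb_values K w L ->
  (forall a b, L a b <= M)%N -> (0 < M)%N -> L x y = M ->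
  exists i : int, L (w (i + 1)) (w i) = M.
Proof.
move=> aw cL maxM M0; have bw := affine_bij aw.
have [k] := ubnP (absz (y - x)); elim: k x => // k IH x lek xy.
have ixy : inverted w x y by rewrite -(csb_supp cL) xy.
have [[x' [xx' x'y]]|last] := pselect (exists x' : int, x < x' /\ L x' y = M).
  apply: (IH x' _ x'y); have := inverted_lt ixy.
  have : inverted w x' y by rewrite -(csb_supp cL) x'y.
  by move/inverted_lt; lia.
have noleg b : pos w y < pos w b -> ~~ inverted w x b.
  move=> yb; apply/negP => ixb; have [d dK eb] := inverted_offset cL ixb.
  have := csb_balanced cL ixy => /andP[_].
  rewrite (_ : arm_from K L x y = 0%N); last first.
    apply: count_eq0P => d'; rewrite xy; apply/negP => /andP[d0 le].
    by apply: last; exists (x + d'%:Z); split; [lia|have := maxM (x + d'%:Z) y; lia].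
  rewrite leqn0 -leqn0 leqNgt -has_count => /hasPn/(_ d dK).
  rewrite -eb yb (csb_supp cL) ixb xy ltn_neqAle maxM andbT /= negbK => /eqP e.
  have := csb_strict cL (a := x) (b := b) (c := y).
  by rewrite (csb_supp cL) e xy => /(_ ixb erefl) eby; rewrite eby ltxx in yb.
set i := pos w y; exists i; rewrite [w i](posK bw); set z := w (i + 1).
have pz : pos w z = i + 1 by rewrite permK.
have [<-//|nzx] := eqVneq x z.
have pzx : pos w z < pos w x.
  have : pos w x != pos w z by rewrite (inj_eq (pos_inj bw)).
  by have := inverted_pos ixy; rewrite -/i pz; lia.
have zx : z < x.
  have : ~~ inverted w x z by apply: noleg; rewrite pz -/i; lia.
  by rewrite /inverted pzx; lia.
have izy : inverted w z y.
  by have := inverted_lt ixy; rewrite /inverted -/i pz; lia.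
have := csb_balanced cL izy => /andP[+ _].
rewrite (_ : leg_below K w L z y = 0%N); last first.
  apply: count_eq0P => d; apply/negP => /andP[l1 /andP[+ _]].
  by rewrite (csb_supp cL) => /inverted_pos; rewrite -/i pz in l1 *; lia.
rewrite leqn0 -leqn0 leqNgt -has_count => /hasPn nab.
have xd : x = z + (absz (x - z))%:Z by lia.
have /nab : absz (x - z) \in iota 0 K.
  by rewrite mem_iota; have := csb_bound cL izy; have := inverted_lt ixy; lia.
by rewrite -xd xy; have := maxM z y; lia.
Qed.

(** The columns are treated from right to left. If the upper of the two rows held the
smaller label X in the column a, and the lower row Y > X, then the hook of the lower
box would have at least as many leg labels below Y, hence at least as many arm labels
from Y on, as the upper one has leg labels below X; but by the columns already treated
the arm of the upper row has one more label above X, namely the maximal one. *)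
Lemma max_adjacent_lt K w L M (i a : int) : affine_perm n w -> csb_values K w L ->
  (forall a b, L a b <= M)%N -> L (w (i + 1)) (w i) = M ->
  (0 < L a (w (i + 1)%R))%N -> (L a (w (i + 1)%R) < L a (w i))%N.
Proof.
move=> aw cL maxM; have bw := affine_bij aw.
set x := w (i + 1); set y := w i => xyM.
have px : pos w x = i + 1 by rewrite permK.
have py : pos w y = i by rewrite permK.
have [k] := ubnP (absz (x - a)); elim: k a => // k IH a lek ax0.
have iax : inverted w a x by rewrite -(csb_supp cL).
have ixy : inverted w x y.
  rewrite -(csb_supp cL) xyM; exact: leq_trans ax0 (maxM _ _).
have [l1 l2 l3] := And3 (inverted_lt iax) (inverted_pos iax) (inverted_lt ixy).
have iay : inverted w a y by rewrite /inverted py; lia.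
have ne : L a x != L a y.
  by apply/eqP => /(csb_strict cL ax0) e; rewrite e ltxx in l3.
rewrite ltnNge leq_eqVlt eq_sym (negPf ne) /=; apply/negP => lt.
have xd : x = a + (absz (x - a))%:Z by lia.
have dK : absz (x - a) \in iota 0 K.
  by rewrite mem_iota; have := csb_bound cL iax; lia.
have := csb_balanced cL iay => /andP[+ _].
rewrite {1}/arm_above (count_D1 _ (iota_uniq _ _) dK) -xd xyM.
rewrite (leq_trans lt (maxM _ _)) add1n ltnNge => /negP; apply.
apply: (@leq_trans (leg_below K w L a x)).
  apply: sub_count => d /= /andP[yb /andP[b0 lb]]; rewrite b0 (ltn_trans lb lt) andbT /=.
  have : pos w (a + d%:Z) != pos w x.
    by apply: contraTneq lb => /(pos_inj bw) ->; rewrite -leqNgt ltnW.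
  by rewrite px py in yb *; lia.
have := csb_balanced cL iax => /andP[_ /leq_trans]; apply.
apply: sub_count => d /= /andP[d0 le].
have ib : inverted w (a + d%:Z) x by rewrite -(csb_supp cL); lia.
have := IH (a + d%:Z); rewrite (csb_supp cL) ib => /(_ _ isT) lt2.
have lbx := inverted_lt ib.
have {}lt2 := lt2 ltac:(lia).
by apply/andP; split; lia.
Qed.

End BalancedCounts.

(** * Removing a maximal label *)

Section Removal.
Variable m : nat.
Local Notation n := m.+2.
Implicit Types (w : int -> int) (L : int -> int -> nat) (K : nat).

Lemma inverted_refl_descent w (x a b : int) : affine_perm n w -> w (x + 1) < w x ->
  inverted (w \o simple_refl (residue m x)) a b =
  inverted w a b && ~~ ((residue m (pos w b) == residue m x) && (pos w a == pos w b + 1)).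
Proof.
move=> aw lt; have bw := affine_bij aw; rewrite /inverted pos_comp_refl //=.
set i := residue m x; have dn y : residue m y = i -> w (y + 1) < w y.
  by move/(ascent_shift aw) => [k [-> ->]]; rewrite ltrD2r.
have [ab|ba|->] := ltgtP a b; [|by []|by rewrite ltxx].
have [pab|pba|/(pos_inj bw)] := ltgtP (pos w a) (pos w b); last by lia.
  apply/negbTE; rewrite -leNgt ltW // (simple_refl_lt i pab).
  apply/negP => /andP[/eqP e /eqP e'].
  by have := dn _ e; rewrite -e' !posK //; lia.
by rewrite (simple_refl_lt i pba).
Qed.

Lemma simple_refl_lt_generic (i : 'Z_n) (p q : int) : residue m p != i ->
  residue m (p - 1) != i -> (simple_refl i p < simple_refl i q) = (p < q).
Proof.
move=> ne1 ne2; have [pq|qp|->] := ltgtP p q; last by rewrite ltxx.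
  by rewrite (simple_refl_lt i pq) (negPf ne1).
apply/negbTE; rewrite -leNgt ltW // (simple_refl_lt i qp).
by apply: contra ne2 => /andP[/eqP <- /eqP ->]; rewrite addrK.
Qed.

Definition remove_class w L (x a b : int) : nat :=
  if (residue m (pos w b) == residue m x) && (pos w a == pos w b + 1) then 0%N
  else L a b.

Section Step.
Variables (K : nat) (w : int -> int) (L : int -> int -> nat) (M : nat) (x : int).
Hypotheses (aw : affine_perm n w) (cL : csb_values m K w L).
Hypotheses (maxM : forall a b, (L a b <= M)%N) (M0 : (0 < M)%N).
Hypothesis (xM : L (w (x + 1)) (w x) = M).

Let i := residue m x.
Let w' := w \o simple_refl i.
Let L' := remove_class w L x.
Let bw := affine_bij aw.

Let class_shift (p : int) : residue m p = i -> L (w (p + 1)) (w p) = M.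
Proof.
move/(ascent_shift aw) => [k [-> ->]]; by rewrite (csb_shift _ _ _ cL).
Qed.

Lemma max_label_descent : w (x + 1) < w x.
Proof. by apply: (@inverted_lt w); rewrite -(csb_supp cL) xM. Qed.

Let remove_le a b : (L' a b <= L a b)%N.
Proof. by rewrite /L' /remove_class; case: ifP. Qed.

Let remove_class_max a b : L' a b = L a b \/ (L' a b = 0%N /\ L a b = M).
Proof.
rewrite /L' /remove_class; case: ifP => [/andP[/eqP e /eqP e']|_]; [right|by left].
by split=> //; rewrite -(class_shift e) -e' !posK.
Qed.

Let remove_other_row a b : residue m (pos w b) != i -> L' a b = L a b.
Proof. by rewrite /L' /remove_class => /negPf ->. Qed.

Let below_max (C : nat) (a b : int) : (C <= M)%N ->
  (0 < L' a b < C)%N = (0 < L a b < C)%N.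
Proof. by move=> CM; case: (remove_class_max a b) => [->//|[-> ->]]; lia. Qed.

Let remove_supp a b : (0 < L' a b)%N = inverted w' a b.
Proof.
rewrite inverted_refl_descent ?max_label_descent // -(csb_supp cL) /L' /remove_class.
by case: ifP; rewrite ?andbT ?andbF.
Qed.

Let pos' : pos w' = simple_refl i \o pos w.
Proof. exact: pos_comp_refl. Qed.

(** In the other rows the arms are unchanged, and the legs only lose boxes with the
maximal label. *)
Let remove_balanced_other (a c : int) : residue m (pos w c) != i ->
  residue m (pos w c - 1) != i -> inverted w a c ->
  (arm_above K L' a c <= leg_below K w' L' a c <= arm_from K L' a c)%N.
Proof.
move=> ne1 ne2 iac.
have -> : arm_above K L' a c = arm_above K L a c.
  by apply: eq_count => d; rewrite !remove_other_row.
have -> : arm_from K L' a c = arm_from K L a c.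
  by apply: eq_count => d; rewrite !remove_other_row.
have -> : leg_below K w' L' a c = leg_below K w L a c; last exact: (csb_balanced cL).
apply: eq_count => d; rewrite (remove_other_row _ ne1) below_max ?maxM //.
by rewrite pos' /= simple_refl_lt_generic.
Qed.

(** The leg of a box of the lower row, which moves up, may gain the box of the upper row;
this one holds a larger label and is not counted. *)
Let remove_balanced_lower (a c : int) : residue m (pos w c - 1) = i -> inverted w a c ->
  (arm_above K L' a c <= leg_below K w' L' a c <= arm_from K L' a c)%N.
Proof.
move=> e iac; have ne : residue m (pos w c) != i.
  by have := @residue_neq m (pos w c - 1); rewrite subrK e.
have -> : arm_above K L' a c = arm_above K L a c.
  by apply: eq_count => d; rewrite !remove_other_row.
have -> : arm_from K L' a c = arm_from K L a c.
  by apply: eq_count => d; rewrite !remove_other_row.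
have -> : leg_below K w' L' a c = leg_below K w L a c; last exact: (csb_balanced cL).
apply: eq_count => d; rewrite (remove_other_row _ ne) below_max ?maxM //.
set b := a + d%:Z; rewrite pos' /=.
have [pq|qp|->] := ltgtP (pos w c) (pos w b); last by rewrite ltxx.
  by rewrite (simple_refl_lt i pq) (negPf ne).
rewrite ltNge le_eqVlt (simple_refl_lt i qp).
rewrite (inj_eq (inv_inj (@simple_reflK m i))) (inj_eq (pos_inj bw)).
have [ebc|nbc] /= := eqVneq b c; first by rewrite ebc ltxx in qp.
rewrite negbK; apply/negbTE/negP => /andP[/andP[_ /eqP e1] /andP[_]].
have ec : c = w (pos w c - 1 + 1) by rewrite subrK posK.
have eb : b = w (pos w c - 1) by rewrite e1 addrK posK.
have := max_adjacent_lt aw cL maxM (class_shift e) (a := a).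
by rewrite -ec -eb (csb_supp cL) iac => /(_ isT); lia.
Qed.

(** For a box of the upper row left of the removed column, the arm loses the label M and
the leg loses the box of the lower row, which holds a smaller label: the counts leg_below
and arm_from both drop by one, and arm_above drops too or is already zero. *)
Let remove_balanced_upper (a c : int) : residue m (pos w c) = i -> inverted w a c ->
  pos w a != pos w c + 1 ->
  (arm_above K L' a c <= leg_below K w' L' a c <= arm_from K L' a c)%N.
Proof.
move=> e iac na; set y := w (pos w c + 1).
have py : pos w y = pos w c + 1 by rewrite permK.
have ycM : L y c = M by rewrite -(class_shift e) posK.
have L'E b : L' b c = if b == y then 0%N else L b c.
  rewrite /L' /remove_class e eqxx -py (inj_eq (pos_inj bw)); by [].
have pos'E b : (pos w' c < pos w' b) = (b != y) && (pos w c < pos w b).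
  rewrite pos' /= -(inj_eq (pos_inj bw)) py.
  have [pq|qp|->] := ltgtP (pos w c) (pos w b); last by rewrite ltxx andbF.
    by rewrite (simple_refl_lt i pq) e eqxx andbT.
  rewrite andbF; apply/negbTE; rewrite -leNgt ltW // (simple_refl_lt i qp).
  apply/negP => /andP[/eqP e1 /eqP e2]; have := @residue_neq m (pos w b).
  by rewrite -e2 e e1 eqxx.
have ay : a != y by rewrite -(inj_eq (pos_inj bw)) py.
have L'ac : L' a c = L a c by rewrite L'E (negPf ay).
have CM : (L a c <= M)%N by [].
pose other (p : pred nat) := count (fun d : nat => (a + d%:Z != y) && p d) (iota 0 K).
have legE : leg_below K w' L' a c = other (fun d : nat =>
    (pos w c < pos w (a + d%:Z)) && (0 < L a (a + d%:Z)%R < L a c)%N).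
  by apply: eq_count => d; rewrite L'ac below_max // pos'E -andbA.
have fromE : arm_from K L' a c =
    other (fun d : nat => (0 < d) && (L a c <= L (a + d%:Z)%R c))%N.
  apply: eq_count => d; rewrite L'ac L'E; case: eqVneq => //= _.
  by have := iac; rewrite -(csb_supp cL); lia.
have aboveE : arm_above K L' a c =
    other (fun d : nat => L a c < L (a + d%:Z)%R c)%N.
  by apply: eq_count => d; rewrite L'ac L'E; case: (_ == y).
rewrite legE fromE aboveE; have := csb_balanced cL iac.
have [lay|lya|eay] := ltgtP a y; last by rewrite eay eqxx in ay.
- have iyc : inverted w y c by rewrite -(csb_supp cL) ycM.
  have iay : inverted w a y.
    by rewrite /inverted lay py; have := inverted_pos iac; move: na; lia.
  have yd : y = a + (absz (y - a))%:Z by lia.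
  have dK : absz (y - a) \in iota 0 K.
    by rewrite mem_iota; have := csb_bound cL iay; lia.
  have D1 p : count p (iota 0 K) = (p (absz (y - a)%R) + other p)%N.
    rewrite (count_D1 _ (iota_uniq _ _) dK); congr (_ + _)%N.
    by apply: eq_count => d; congr (_ && _); lia.
  rewrite /leg_below /arm_from /arm_above !D1 -yd ycM py ltrDl ltr01 (csb_supp cL) iay CM.
  have := max_adjacent_lt aw cL maxM (class_shift e) (a := a).
  rewrite -/y posK // (csb_supp cL) iay => /(_ isT) -> /=.
  rewrite (_ : (0 < absz (y - a))%N) /=; last by lia.
  have [ltM|leM] := ltnP (L a c) M; first by rewrite !add1n !ltnS.
  rewrite add0n !add1n ltnS => /andP[_ ->]; rewrite andbT.
  rewrite /other count_eq0P // => d.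
  by apply/negP => /andP[_]; have := maxM (a + d%:Z) c; lia.
- have dE d : a + d%:Z != y by lia.
  have D0 p : other p = count p (iota 0 K).
    by apply: eq_count => d; rewrite dE.
  by rewrite /leg_below /arm_from /arm_above !D0.
Qed.

Lemma remove_class_csb : csb_values m K w' L'.
Proof.
split.
- move=> a b; rewrite -remove_supp => pl; apply: (csb_bound cL).
  by rewrite -(csb_supp cL); exact: leq_trans pl (remove_le _ _).
- exact: remove_supp.
- move=> a b; rewrite /L' /remove_class !(affine_pos_equivariant aw) residue_period.
  by rewrite addrAC (inj_eq (addIr _)) (csb_period cL).
- move=> a b c p e.
  have p' : (0 < L' a c)%N by rewrite -e.
  case: (remove_class_max a b) (remove_class_max a c) p p' => [eb|[-> //]].
  case=> [ec|[-> //]] p p'; apply: (csb_strict cL (a := a)); first by rewrite -eb.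
  by rewrite -eb -ec.
- move=> a c; rewrite inverted_refl_descent ?max_label_descent // => /andP[iac nc].
  have [e|ne1] := eqVneq (residue m (pos w c)) i.
    by apply: remove_balanced_upper => //; move: nc; rewrite e eqxx.
  have [e|ne2] := eqVneq (residue m (pos w c - 1)) i.
    exact: remove_balanced_lower.
  exact: remove_balanced_other.
Qed.

End Step.

(** Maximal labels are removed one class at a time, until the bound t is reached; the
boxes that remain form the diagram of u. *)
Lemma csb_prefix K w L t : affine_perm n w -> csb_values m K w L ->
  exists2 u, affine_perm n u & forall a b, inverted u a b = (0 < L a b <= t)%N.
Proof.
have [k] := ubnP (affine_length n w); elim: k w L => // k IH w L lek aw cL.
have [M maxM Mmin] := csb_least_bound cL.
have [Mt|tM] := leqP M t.
  exists w => // a b; rewrite -(csb_supp cL).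
  by rewrite (leq_trans (maxM _ _) Mt) andbT.
have [a [b eM]] : exists a b, L a b = M.
  apply: contrapT => no; have /Mmin : forall a b, (L a b <= M.-1)%N.
    move=> a b; have := maxM a b; rewrite leq_eqVlt => /orP[/eqP e|]; last by lia.
    by case: no; exists a, b.
  by lia.
have M0 : (0 < M)%N by lia.
have [x xM] := max_label_adjacent aw cL maxM M0 eM.
have lw := affine_length_descent aw (max_label_descent cL M0 xM).
have cL' := remove_class_csb aw cL maxM M0 xM.
have [|u au iu] := IH _ _ _ (affine_perm_refl (residue m x) aw) cL'; first by lia.
exists u => // a' b'; rewrite iu /remove_class; case: ifP => // /andP[/eqP e /eqP e'].
have [k' [ek1 ek2]] := ascent_shift aw e.
have -> : L a' b' = M; last by lia.
rewrite -xM -[RHS](csb_shift _ _ k' cL) -ek1 -ek2 -e' !posK //; exact: (affine_bij aw).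
Qed.

End Removal.

(** * Balanced hooks *)

Lemma sub_in_count (X : eqType) (p q : pred X) (s : seq X) :
  {in s, forall x, p x -> q x} -> (count p s <= count q s)%N.
Proof.
move=> sub; rewrite (@eq_in_count _ p (predI p q)) => [|x xs /=].
  by apply: sub_count => x /andP[].
by case: (boolP (p x)) => // /(sub x xs) ->.
Qed.

Section Rearrangement.
Variables (X : eqType) (s : seq X) (T : X -> nat) (key : X -> int) (c : X).
Hypotheses (us : uniq s) (cs : c \in s) (key_inj : {in s &, injective key}).

(** A rearrangement that is monotone for the key puts at c the label whose rank among
the labels is the rank of c among the keys; the labels equal to T c occupy the ranks
between the two counts. *)
Lemma rearrangementP :
  (exists sigma : X -> X,
     [/\ set_bij [set x | x \in s] [set x | x \in s] sigma,
         {in s &, forall x y, key x <= key y -> (T (sigma x) <= T (sigma y))%N}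
       & T (sigma c) = T c]) <->
  (count (fun x => T x < T c)%N s <= count (fun x => key x < key c)%R s
     < count (fun x => T x <= T c)%N s)%N.
Proof.
split.
- case=> sigma [[sub inj surj] mono fixc].
  have perm : perm_eq (map sigma s) s.
    apply: uniq_perm => // [|x].
      rewrite map_inj_in_uniq // => x y xs ys; apply: inj; exact/mem_set.
    apply/mapP/idP => [[y ys ->]|xs]; first exact: sub.
    by have [y ys <-] := surj x xs; exists y.
  have cnt p : count p s = count (p \o sigma) s.
    by rewrite -[RHS](count_map sigma p); move/seq.permP: perm => ->.
  rewrite (cnt (fun x => T x < T c)%N) (cnt (fun x => T x <= T c)%N).
  apply/andP; split.
    apply: sub_in_count => x xs /=; rewrite -fixc ltnNge; apply: contraNT.
    by rewrite -leNgt; exact: mono.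
  rewrite [X in (_ < X)%N](count_D1 _ us cs) /= fixc leqnn add1n ltnS.
  apply: sub_in_count => x xs /= lt; apply/andP; split.
    by apply: contraTneq lt => ->; rewrite ltxx.
  by rewrite -fixc; apply: mono => //; exact: ltW.
- case/andP=> le lt.
  pose e1 := sort (fun x y => key x <= key y) s.
  pose e2 := sort (fun x y => T x <= T y)%N s.
  have m1 x : (x \in e1) = (x \in s) by rewrite mem_sort.
  have m2 x : (x \in e2) = (x \in s) by rewrite mem_sort.
  have s1 : size e1 = size s by rewrite size_sort.
  have s2 : size e2 = size s by rewrite size_sort.
  have u1 : uniq e1 by rewrite sort_uniq.
  have u2 : uniq e2 by rewrite sort_uniq.
  have lt1 : sorted <%R (map key e1).
    rewrite lt_sorted_uniq_le map_inj_in_uniq ?u1 /=; last first.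
      by move=> x y; rewrite !m1; exact: key_inj.
    by rewrite sorted_map; apply: sort_sorted => x y; exact: le_total.
  have le2 : sorted <=%O (map T e2).
    by rewrite sorted_map; apply: sort_sorted => x y; exact: leq_total.
  have i1 x : x \in s -> (index x e1 < size s)%N by rewrite -s1 index_mem m1.
  pose sigma x := nth c e2 (index x e1).
  have rank : index c e1 = count (fun x => key x < key c)%R s.
    have ic : (index c e1 < size (map key e1))%N by rewrite size_map s1 i1.
    rewrite -[LHS](count_lt_nth 0 lt1 ic) (nth_map c) ?nth_index ?m1 //; last first.
      by rewrite s1 i1.
    by rewrite count_map; apply/seq.permP; rewrite perm_sort.
  exists sigma; split.
  + split.
    * by move=> x /= xs; rewrite -m2 mem_nth // s2 i1.
    * move=> x y /set_mem /= xs /set_mem /= ys /eqP.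
      rewrite nth_uniq ?s2 ?i1 // => /eqP e.
      by rewrite -[x](nth_index c (s := e1)) ?m1 // e nth_index ?m1.
    * move=> y /= ys; exists (nth c e1 (index y e2)) => /=.
        by rewrite -m1 mem_nth // s1 -s2 index_mem m2.
      by rewrite /sigma index_uniq ?nth_index ?m2 // s1 -s2 index_mem m2.
  + move=> x y xs ys le1.
    have ixy : (index x e1 <= index y e1)%N.
      rewrite leqNgt; apply/negP => lt2.
      have := sorted_ltn_nth lt_trans 0 lt1 (index y e1) (index x e1).
      rewrite !inE size_map s1 !i1 // => /(_ isT isT lt2).
      by rewrite !(nth_map c) ?s1 ?i1 // !nth_index ?m1 //; lia.
    have := sorted_leq_nth le_trans le_refl 0%N le2 (index x e1) (index y e1).
    rewrite !inE size_map s2 !i1 // => /(_ isT isT ixy).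
    by rewrite !(nth_map c) ?s2 ?i1.
  + have : nth 0%N (map T e2) (index c e1) = T c.
      apply: nth_count_eq => //; rewrite rank !count_map.
      have -> : count (preim T (< T c)%O) e2 = count (fun x => T x < T c)%N s.
        by apply/seq.permP; rewrite perm_sort.
      have -> : count (preim T (<= T c)%O) e2 = count (fun x => T x <= T c)%N s.
        by apply/seq.permP; rewrite perm_sort.
      by rewrite le lt.
    by rewrite (nth_map c) // s2 i1.
Qed.

End Rearrangement.

Section Hooks.
Variables (w : int -> int) (T : box -> nat) (K : nat).
Hypothesis bw : bijective w.

Definition value_label (a b : int) : nat := T (pos w b, a).

Lemma diagramE b : diagram w b <-> inverted w b.2 (w b.1).
Proof.
split=> [[i [j [ij wij ->]]]|]; first by rewrite /inverted /= wij !permK.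
case: b => r a /andP[/= lt]; rewrite permK // => rp.
by exists r, (pos w a); rewrite posK.
Qed.

Lemma inverted_diagram a b : inverted w a b <-> diagram w (pos w b, a).
Proof. by rewrite diagramE /= posK. Qed.

Hypothesis bound : forall a b, inverted w a b -> b < a + K%:Z.
Hypothesis supp : forall a b, (0 < value_label a b)%N = inverted w a b.
Hypothesis strict : forall a b c, (0 < value_label a b)%N ->
  value_label a b = value_label a c -> b = c.

(** The rearranged corner label is the one whose rank is the length of the arm. No leg
label equals the corner label C, so comparing the arm with its labels below C, equal to C
and above C turns the condition on ranks into two inequalities between counts. *)
Lemma balanced_hookE (a c : int) : inverted w a c ->
  balanced_hook w T (pos w c, a) <->
  (arm_above K value_label a c <= leg_below K w value_label a c
     <= arm_from K value_label a c)%N.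
Proof.
move=> iac; set L := value_label.
pose armP (d : nat) := (0 < d)%N && (0 < L (a + d%:Z)%R c)%N.
pose legP (d : nat) := (pos w c < pos w (a + d%:Z)) && (0 < L a (a + d%:Z)%R)%N.
pose arm := [seq (pos w c, a + d%:Z) | d <- iota 0 K & armP d].
pose leg := [seq (pos w (a + d%:Z), a) | d <- iota 0 K & legP d].
pose s : seq box := arm ++ (pos w c, a) :: leg.
(* this difference increases from the end of the arm to the corner and on to the
   end of the leg *)
pose key (b : box) : int := b.1 - b.2.
have arm_in b : b \in arm -> [/\ b.1 = pos w c, a < b.2 & inverted w b.2 c].
  case/mapP => d; rewrite mem_filter => /andP[/andP[d0 l0] _] -> /=.
  by rewrite -supp; split=> //; lia.
have leg_in b : b \in leg -> [/\ b.2 = a, pos w c < b.1 & inverted w a (w b.1)].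
  case/mapP => d; rewrite mem_filter => /andP[/andP[d0 l0] _] -> /=.
  by rewrite -supp posK.
have sP b : b \in s <-> hook w (pos w c, a) b.
  rewrite mem_cat inE /hook /=; split.
    case/or3P => [/arm_in[e1 lt ib]|/eqP->|/leg_in[e2 lt ib]].
    - by split; [apply/diagramE; rewrite e1 posK|left; rewrite e1 ltW].
    - by split; [apply/inverted_diagram|left].
    - by split; [apply/diagramE; rewrite e2|right; rewrite e2 ltW].
  case=> /diagramE ib; have := bound ib; have := inverted_lt ib.
  case: b ib => r q /= ib lt1 lt2 [[er le]|[le eq]].
    have [->|ne] := eqVneq q a; first by rewrite er eqxx orbT.
    apply/orP; left; apply/mapP; exists (absz (q - a)); last by congr pair; lia.
    have qE : a + (absz (q - a))%:Z = q by lia.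
    rewrite mem_filter mem_iota /armP qE supp.
    rewrite er posK // in ib lt1 lt2; rewrite ib; have := bound iac; lia.
  have [->|ne] := eqVneq r (pos w c); first by rewrite eq eqxx orbT.
  apply/or3P; apply: Or33; apply/mapP; exists (absz (w r - a)); rewrite eq in ib lt1 lt2 *.
    have qE : a + (absz (w r - a))%:Z = w r by lia.
    by rewrite mem_filter mem_iota /legP qE supp ib permK //; lia.
  have -> : a + (absz (w r - a))%:Z = w r by lia.
  by rewrite permK.
have us : uniq s.
  rewrite cat_uniq /= !map_inj_in_uniq ?filter_uniq ?iota_uniq //=.
  - rewrite andbT; apply/andP; split; last by apply/negP => /leg_in[_ /=]; rewrite ltxx.
    rewrite negb_or; apply/andP; split; first by apply/negP => /arm_in[_ /=]; rewrite ltxx.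
    by apply/hasPn => b /leg_in[_ l1 _]; apply/negP => /arm_in[e _ _]; rewrite e ltxx in l1.
  - by move=> d d' _ _ [] /(pos_inj bw); lia.
  - by move=> d d' _ _ []; lia.
have cs : (pos w c, a) \in s by rewrite mem_cat inE eqxx orbT.
have key_cases b : b \in s -> (b.1 = pos w c /\ a <= b.2) \/ (b.2 = a /\ pos w c <= b.1).
  rewrite mem_cat inE => /or3P[/arm_in[e l _]|/eqP->|/leg_in[e l _]].
  - by left; rewrite e ltW.
  - by left.
  - by right; rewrite e ltW.
have key_inj : {in s &, injective key}.
  case=> [r q] [r' q'] /key_cases/= c1 /key_cases/= c2; rewrite /key /= => e.
  by congr pair; lia.
have hookE : hook w (pos w c, a) = [set b | b \in s].
  by apply/seteqP; split=> b /sP.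
have countE p : count p s =
    (count (fun d => armP d && p (pos w c, a + d%:Z)%R) (iota 0 K) + p (pos w c, a) +
     count (fun d => legP d && p (pos w (a + d%:Z), a)%R) (iota 0 K))%N.
  rewrite count_cat /= addnA; congr (_ + _ + _)%N; rewrite count_map count_filter.
    by apply: eq_count => d; rewrite /= andbC.
  by apply: eq_count => d; rewrite /= andbC.
pose C := L a c; have C0 : (0 < C)%N by rewrite supp.
have -> : balanced_hook w T (pos w c, a) <->
    (count (fun b => T b < C)%N s <= count (fun b => key b < key (pos w c, a))%R s
       < count (fun b => T b <= C)%N s)%N.
  rewrite -(rearrangementP T us cs key_inj) /balanced_hook hookE.
  split=> -[sigma]; last first.
    case=> bij mono fixc; exists sigma; split=> // -[r q] [r' q'] bs bs' /= e e' le.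
      by apply: mono => //; rewrite /key /= e e'; lia.
    by apply: mono => //; rewrite /key /= e e'; lia.
  case=> bij mono1 mono2 fixc; exists sigma; split=> // -[r q] [r' q'] bs bs'; rewrite /key.
  have /= [[e1 l1]|[e1 l1]] := key_cases _ bs;
    have /= [[e2 l2]|[e2 l2]] := key_cases _ bs' => le.
  - by apply: mono1 => //=; lia.
  - by apply: (@leq_trans (T (sigma (pos w c, a)))); [apply: mono1|apply: mono2].
  - by apply: mono1 => //=; lia.
  - by apply: mono2 => //=; lia.
have split (p q : pred nat) r : count p r =
    (count (fun d => p d && q d) r + count (fun d => p d && ~~ q d) r)%N.
  by elim: r => //= d r ->; case: (p d); case: (q d); lia.
have keyE : count (fun b => key b < key (pos w c, a))%R s = count armP (iota 0 K).
  rewrite countE /key /= ltxx addn0 [X in (_ + X)%N]count_eq0P ?addn0 => [|d].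
    by apply: eq_count => d; rewrite /armP; lia.
  by apply/negP => /andP[/andP[l _]]; lia.
have fromE : arm_from K L a c = count (fun d => armP d && ~~ (L (a + d%:Z)%R c < C)%N) (iota 0 K).
  by apply: eq_count => d; rewrite /armP -/C; lia.
have aboveE : arm_above K L a c =
    count (fun d => armP d && ~~ (L (a + d%:Z)%R c <= C)%N) (iota 0 K).
  apply: eq_count => d; rewrite /armP -/C; case: d => [|d]; last by lia.
  by rewrite addr0 -/C ltnn.
have legE : leg_below K w L a c = count (fun d => legP d && (L a (a + d%:Z)%R < C)%N) (iota 0 K).
  by apply: eq_count => d; rewrite /legP -/C andbA.
have legE' : leg_below K w L a c = count (fun d => legP d && (L a (a + d%:Z)%R <= C)%N) (iota 0 K).
  rewrite legE; apply: eq_count => d; rewrite [in RHS]leq_eqVlt.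
  case: (boolP (legP d)) => //= /andP[l _]; case: eqP => //= e.
  by have ec := strict C0 (esym e); rewrite -ec ltxx in l.
rewrite keyE !countE -![T (pos w c, _)]/(L _ c) -/C ltnn leqnn.
rewrite -[X in (_ + X <= _)%N]legE -[X in (_ < _ + X)%N]legE' fromE aboveE.
have := split armP (fun d => L (a + d%:Z)%R c < C)%N (iota 0 K).
have := split armP (fun d => L (a + d%:Z)%R c <= C)%N (iota 0 K).
rewrite /L /value_label addn0 addn1 -/L.
move: (leg_below _ _ _ _ _) => g; move: (count armP _) => A.
move: (count _ _) => A1; move: (count _ _) => A2; move: (count _ _) => A3.
move: (count _ _) => A4 e1 e2; by split=> /andP[? ?]; apply/andP; split; lia.
Qed.

End Hooks.

(** * From factorizations to labellings *)

Section Chains.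
Variable m : nat.
Local Notation n := m.+2.
Implicit Types (u : nat -> int -> int) (L : int -> int -> nat).

Lemma not_inverted_pos v (a b : int) : bijective v -> a < b -> ~~ inverted v a b ->
  pos v a < pos v b.
Proof.
move=> bv ab; rewrite /inverted ab /= -leNgt le_eqVlt (inj_eq (pos_inj bv)).
by case/orP => // /eqP e; rewrite e ltxx in ab.
Qed.

(** For a < b < c, a permutation that inverts (a, b) and (b, c) inverts (a, c), and one
that inverts (a, c) inverts one of the other two pairs. Applied to the permutations u k,
this yields the hook inequalities offset by offset. A single jump moves a value a past
at most one larger value, so the labels in a column are distinct. *)
Lemma chain_csb K w L u :
  affine_perm n w -> (forall a b, inverted w a b -> b < a + K%:Z) ->
  (forall a b, (0 < L a b)%N = inverted w a b) -> (forall k, affine_perm n (u k)) ->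
  (forall k a b, inverted (u k) a b = (0 < L a b <= k)%N) ->
  (forall k, single_jump (pos (u k) \o u k.+1)) -> csb_values m K w L.
Proof.
move=> aw bound supp au iu sj.
have bu k := affine_bij (au k).
have strict a b c : (0 < L a b)%N -> L a b = L a c -> b = c.
  move=> p e; set k := (L a b).-1; have kE : L a b = k.+1 by rewrite prednK.
  have ib : inverted (u k.+1) a b by rewrite iu kE /=.
  have ic : inverted (u k.+1) a c by rewrite iu -e kE /=.
  have nb : ~~ inverted (u k) a b by rewrite iu kE ltnn andbF.
  have nc : ~~ inverted (u k) a c by rewrite iu -e kE ltnn andbF.
  apply: (pos_inj (bu k.+1)); apply: (sj k (pos (u k.+1) a)).
  - exact: inverted_pos ib.
  - exact: inverted_pos ic.
  - by rewrite /= !posK //; exact: not_inverted_pos (inverted_lt ib) nb.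
  - by rewrite /= !posK //; exact: not_inverted_pos (inverted_lt ic) nc.
split=> //.
- move=> a b; have eq k : (0 < L (a + n%:Z)%R (b + n%:Z)%R <= k)%N = (0 < L a b <= k)%N.
    by rewrite -!iu -(inverted_shift a b 1 (au k)) mul1r.
  by have := eq (L a b); have := eq (L (a + n%:Z) (b + n%:Z)); lia.
- move=> a c iac; have C0 : (0 < L a c)%N by rewrite supp.
  apply/andP; split; apply: sub_count => d /=; set b := a + d%:Z.
    move=> lt; have ibc : inverted w b c by rewrite -supp; exact: leq_ltn_trans lt.
    have nd : a < b.
      by rewrite /b; case: d @b lt {ibc} => [|d] b lt; [rewrite /b addr0 ltnn in lt|lia].
    have iC : inverted (u (L a c)) a c by rewrite iu C0 leqnn.
    have nC : ~~ inverted (u (L a c)) b c by rewrite iu negb_and; apply/orP; right; rewrite -ltnNge.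
    have := not_inverted_pos (bu _) (inverted_lt ibc) nC.
    have := inverted_pos iC => l1 l2.
    have : inverted (u (L a c)) a b by rewrite /inverted nd; exact: lt_trans l2 l1.
    rewrite iu (inverted_pos ibc) => /andP[-> le] /=; rewrite ltn_neqAle le andbT.
    apply/eqP => /esym/(strict _ _ _ C0) e.
    by have := inverted_lt ibc; rewrite e ltxx.
  case/andP=> cb /andP[b0 lt]; set k := (L a c).-1.
  have iab : inverted (u k) a b by rewrite iu b0 /k; lia.
  have nac : ~~ inverted (u k) a c by rewrite iu C0 /k; lia.
  have l1 := not_inverted_pos (bu k) (inverted_lt iac) nac.
  have l2 := inverted_pos iab; have ab := inverted_lt iab.
  apply/andP; split; first by move: ab; rewrite /b; lia.
  rewrite leqNgt; apply/negP => ltb.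
  have [bc|bc|e] := ltgtP b c; last by rewrite e ltnn in lt.
    have : inverted (u k) b c.
      by rewrite iu supp /inverted bc cb /k; move: ltb; lia.
    by move/inverted_pos; lia.
  have : inverted (u k) c b by rewrite /inverted bc; exact: lt_trans l2 l1.
  by rewrite iu supp => /andP[/inverted_pos + _]; lia.
Qed.

End Chains.

Section Factorizations.
Variables (m : nat) (w : int -> int).
Local Notation n := m.+2.
Hypothesis aw : affine_perm n w.
Let bw := affine_bij aw.

Lemma csb_labellingsE K T : (forall a b, inverted w a b -> b < a + K%:Z) ->
  csb_labellings n w T <->
  (forall b, ~ diagram w b -> T b = 0%N) /\ csb_values m K w (value_label w T).
Proof.
move=> bound; set L := value_label w T.
have boxE r a : T (r, a) = L a (w r) by rewrite /L /value_label permK.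
split.
- case=> -[supp per] bal strict.
  have suppL a b : (0 < L a b)%N = inverted w a b.
    apply/idP/idP; first by move=> /(supp _).1 /(inverted_diagram bw).
    by move/(inverted_diagram bw)/(supp _).2.
  have strictL a b c : (0 < L a b)%N -> L a b = L a c -> b = c.
    move=> p e; have p' : (0 < L a c)%N by rewrite -e.
    have [] := strict _ _ ((supp _).1 p) ((supp _).1 p') erefl e.
    exact: pos_inj.
  split=> [b nb|]; first by apply/eqP; rewrite -leqn0 leqNgt; apply/negP => /(supp _).1.
  split=> // [a b|a c iac].
    rewrite /L /value_label (affine_pos_equivariant aw).
    have := @inverted_shift m w a b 1 aw; rewrite mul1r.
    have [ib sh|nb sh] := boolP (inverted w a b).
      by rewrite [RHS]per //; exact/(inverted_diagram bw).
    have z a' b' : ~~ inverted w a' b' -> T (pos w b', a') = 0%N.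
      by rewrite -suppL lt0n negbK => /eqP.
    by rewrite z // -(affine_pos_equivariant aw) z // sh.
  apply/(balanced_hookE bw bound suppL strictL iac); apply: bal.
  exact/(inverted_diagram bw).
- case=> out cL; have suppL := csb_supp cL.
  have supp b : (0 < T b)%N <-> diagram w b.
    by case: b => r a; rewrite boxE suppL; exact: iff_sym (diagramE bw (r, a)).
  split.
  + split=> // -[r a] /= d; rewrite !boxE (affine_equivariant aw).
    by rewrite (csb_period cL).
  + move=> [r a] /(diagramE bw)/= ib; rewrite -[r](permK bw).
    by apply/(balanced_hookE bw bound suppL (csb_strict cL) ib); exact: (csb_balanced cL).
  + move=> [r a] [r' a'] /supp; rewrite !boxE /= => p _ <-{a'}.
    by move/(csb_strict cL p)/(bij_inj bw) => ->.
Qed.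

Definition prefix (s : seq (int -> int)) k := prod_funs (take k s).

Lemma prod_funs_cat (s t : seq (int -> int)) :
  prod_funs (s ++ t) = prod_funs s \o prod_funs t.
Proof. by elim: s => //= f s ->. Qed.

Lemma prefixS s k : prefix s k.+1 = prefix s k \o nth id s k.
Proof.
rewrite /prefix; have [lt|le] := ltnP k (size s).
  by rewrite (take_nth id) // -cats1 prod_funs_cat.
by rewrite !take_oversize ?nth_default // ltnW.
Qed.

Lemma prefix_oversize s k : (size s <= k)%N -> prefix s k = prod_funs s.
Proof. by move=> le; rewrite /prefix take_oversize. Qed.

Section OneFactorization.
Variable s : seq (int -> int).
Hypothesis fs : cd_factorizations n w s.

Local Notation len := (affine_length n).

Lemma factor_cd k : cyclically_decreasing n (nth id s k).
Proof.
case: fs => cd _ _ _; have [/cd//|le] := ltnP k (size s).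
rewrite nth_default //; apply/cyclically_decreasingE; first exact: affine_perm_id.
by move=> x y1 y2; lia.
Qed.

Lemma factor_affine k : affine_perm n (nth id s k).
Proof. by case: (factor_cd k). Qed.

Lemma prefix_affine k : affine_perm n (prefix s k).
Proof.
elim: k => [|k IH]; first by rewrite /prefix take0; exact: affine_perm_id.
by rewrite prefixS; apply: affine_perm_comp IH (factor_affine k).
Qed.

Lemma prefix_full k : (size s <= k)%N -> prefix s k = w.
Proof. by move/prefix_oversize ->; case: fs. Qed.

(** Subadditivity of the length bounds both a prefix and the remaining factors, and the
length of w is the sum of all. *)
Lemma prefix_length k : len (prefix s k) = (\sum_(i < k) len (nth id s i))%N.
Proof.
have [S SE] : exists S, forall j, S j = (\sum_(i < j) len (nth id s i))%N by eexists.
have S0 : S 0%N = 0%N by rewrite SE big_ord0.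
have SS j : S j.+1 = (S j + len (nth id s j))%N by rewrite !SE big_ord_recr.
have sub j : (len (prefix s j.+1) <= len (prefix s j) + len (nth id s j))%N.
  by rewrite prefixS; exact: affine_length_comp (prefix_affine j) (factor_affine j).
have up j : (len (prefix s (k + j)) + S k <= len (prefix s k) + S (k + j))%N.
  elim: j => [|j IH]; first by rewrite addn0.
  by rewrite addnS SS; have := sub (k + j)%N; lia.
have full : len w = S (k + size s)%N.
  have total : len w = S (size s).
    by case: fs => _ _ -> _; rewrite SE (big_nth id) big_mkord.
  rewrite total addnC; elim: (k) => [|j IH]; first by rewrite addn0.
  by rewrite addnS SS -IH nth_default ?leq_addr // affine_length_id addn0.
have le : (len (prefix s k) <= S k)%N.
  elim: (k) => [|j IH]; first by rewrite /prefix take0 affine_length_id.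
  by rewrite SS; have := sub j; lia.
rewrite -SE; have := up (size s); rewrite prefix_full ?leq_addl // full.
by lia.
Qed.

Lemma prefix_lengthS k : len (prefix s k.+1) = (len (prefix s k) + len (nth id s k))%N.
Proof. by rewrite !prefix_length big_ord_recr. Qed.

Lemma prefix_mono k k' a b : (k <= k')%N ->
  inverted (prefix s k) a b -> inverted (prefix s k') a b.
Proof.
move/subnKC <-; elim: (k' - k)%N => [|j IH]; first by rewrite addn0.
move/IH; rewrite addnS prefixS.
apply: (length_add_inverted (prefix_affine _) (factor_affine _)).1.
by rewrite -prefixS prefix_lengthS.
Qed.

(** The index 0 stands for the empty product, which has no inversions, so boxes get positive
labels and the k-th factor, at the index k - 1 of s, gives the label k. *)
Definition factor_label (b : box) : nat :=
  if `[< diagram w b >] then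
    find (fun k => inverted (prefix s k) b.2 (w b.1)) (iota 0 (size s).+1)
  else 0%N.

Lemma factor_labelP k a b :
  inverted (prefix s k) a b = (0 < value_label w factor_label a b <= k)%N.
Proof.
rewrite /value_label /factor_label; case: asboolP => [|no]; last first.
  rewrite ltnn /=.
  apply/negP => ib; apply: no; apply/(inverted_diagram bw).
  by rewrite -(prefix_full (leq_addl k _)); apply: prefix_mono ib; exact: leq_addr.
move=> /(inverted_diagram bw) ib.
rewrite -[(pos w b, a).1]/(pos w b) -[(pos w b, a).2]/a posK //.
set p := fun _ => _; set f := find _ _.
have hp : has p (iota 0 (size s).+1).
  by apply/hasP; exists (size s); rewrite ?mem_iota //= /p prefix_full.
have flt : (f < (size s).+1)%N by have := hp; rewrite has_find size_iota; exact.
have pf : p f by have := nth_find 0%N hp; rewrite nth_iota.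
have f0 : (0 < f)%N.
  rewrite lt0n; apply: contraTneq pf => ->; rewrite /p /prefix take0 /=.
  by rewrite /inverted (@pos_unique id id) //; lia.
rewrite f0 /=; have [fk|kf] := leqP f k; first exact: (prefix_mono fk).
by have := before_find 0%N kf; rewrite nth_iota //; exact: ltn_trans kf flt.
Qed.

Lemma factor_label_csb : csb_labellings n w factor_label.
Proof.
have [K bound] := inverted_bound aw.
apply/(csb_labellingsE _ bound); split.
  by move=> b nb; rewrite /factor_label; case: asboolP.
apply: (@chain_csb _ K w _ (prefix s)) => //.
- move=> a b; set l := value_label _ _ _ _.
  have <- : inverted (prefix s (size s + l)) a b = inverted w a b.
    by rewrite prefix_full // leq_addr.
  by rewrite factor_labelP leq_addl andbT.
- exact: prefix_affine.
- exact: factor_labelP.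
- move=> k; rewrite prefixS.
  rewrite (_ : _ \o _ = nth id s k); last first.
    by apply/funext => x /=; rewrite permK //; exact: affine_bij (prefix_affine k).
  exact/(cyclically_decreasingE (factor_affine k))/factor_cd.
Qed.

End OneFactorization.
End Factorizations.

(** * From labellings to factorizations *)

Section Bijection.
Variables (m : nat) (w : int -> int).
Local Notation n := m.+2.
Hypothesis aw : affine_perm n w.
Let bw := affine_bij aw.
Local Notation len := (affine_length n).

Lemma eq_of_thresholds (x y : nat) :
  (forall k, (0 < x <= k)%N = (0 < y <= k)%N) -> x = y.
Proof. by move=> e; have := e x; have := e y; lia. Qed.

(** The labels determine the inversions of all prefixes, hence the factors; the sizes agree
because the last factor is not the identity. *)
Lemma factor_label_inj s s' : cd_factorizations n w s -> cd_factorizations n w s' ->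
  factor_label w s = factor_label w s' -> s = s'.
Proof.
move=> fs fs' e.
have pre k : prefix s k = prefix s' k.
  apply: (@inverted_inj m); [exact: (prefix_affine fs)|exact: (prefix_affine fs')|].
  by move=> a b; rewrite (factor_labelP aw fs) (factor_labelP aw fs') e.
have nthE k : nth id s k = nth id s' k.
  have bk := affine_bij (prefix_affine fs k).
  apply/funext => x; apply: (bij_inj bk).
  by have := congr1 (fun f => f x) (pre k.+1); rewrite !prefixS /= -pre.
have szle (t t' : seq (int -> int)) : cd_factorizations n w t' ->
    (forall k, nth id t k = nth id t' k) -> (size t' <= size t)%N.
  move=> [_ _ _ tr] et; rewrite leqNgt; apply/negP => lt.
  case/lastP: t' => [//|t' f] in lt tr et *.
  apply: (tr t'); congr rcons.
  have := et (size t'); rewrite nth_rcons ltnn eqxx nth_default //.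
  by move: lt; rewrite size_rcons.
apply: (eq_from_nth (x0 := id)) => [|k _]; last exact: nthE.
by apply/eqP; rewrite eqn_leq !szle.
Qed.

(** The boxes with labels at most k form the inversions of some u k, and the factors are the
quotients of consecutive u k. A factor is cyclically decreasing by column strictness: two
larger values overtaking the same value a would give equal labels in the column a. *)
Lemma factor_label_surj T : csb_labellings n w T ->
  exists2 s, cd_factorizations n w s & factor_label w s = T.
Proof.
move=> csbT; have [K bound] := inverted_bound aw.
have [_ cL] := (csb_labellingsE aw T bound).1 csbT.
set L := value_label w T in cL.
have [u uP] : exists u : nat -> int -> int, forall k,
    affine_perm n (u k) /\ forall a b, inverted (u k) a b = (0 < L a b <= k)%N.
  have ex k : exists v, affine_perm n v /\ forall a b, inverted v a b = (0 < L a b <= k)%N.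
    by have [v av iv] := csb_prefix k aw cL; exists v.
  by have [u uP] := choice ex; exists u.
have au k := (uP k).1; have iu k := (uP k).2; have bu k := affine_bij (au k).
have [M maxM Mmin] := csb_least_bound cL.
have u0 : u 0%N = id.
  apply: (@inverted_inj m) => // [|a b]; first exact: affine_perm_id.
  by rewrite iu /inverted (@pos_unique id id) //; lia.
have uM k : (M <= k)%N -> u k = w.
  move=> Mk; apply: (@inverted_inj m) => // a b.
  by rewrite iu -(csb_supp cL) (leq_trans (maxM _ _) Mk) andbT.
pose v k := pos (u k) \o u k.+1.
have uS k : u k.+1 = u k \o v k by apply/funext => x; rewrite /v /= posK.
have av k : affine_perm n (v k) by apply: affine_perm_comp (affine_perm_pos (au k)) (au k.+1).
pose s := mkseq v M.
have pre k : (k <= M)%N -> prefix s k = u k.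
  elim: k => [|k IH] kM; first by rewrite /prefix take0 u0.
  by rewrite prefixS nth_mkseq // IH ?uS // ltnW.
have sM : size s = M by rewrite size_mkseq.
have lenS k : len (u k.+1) = (len (u k) + len (v k))%N.
  rewrite uS; apply/(length_add_inverted (au k) (av k)) => a b.
  by rewrite -uS !iu => /andP[-> /leqW].
have fs : cd_factorizations n w s.
  split.
  - move=> k; rewrite sM => kM; rewrite nth_mkseq //.
    apply/(cyclically_decreasingE (av k)) => x y1 y2 lt1 lt2.
    have step y : y < x -> v k x < v k y ->
        (0 < L (u k.+1 x) (u k.+1 y))%N /\ L (u k.+1 x) (u k.+1 y) = k.+1.
      move=> yx; rewrite /v /= => lt; set a := u k.+1 x; set b := u k.+1 y.
      have ab : a < b.
        have : a != b by rewrite (inj_eq (bij_inj (bu k.+1))); lia.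
        rewrite neq_lt => /orP[//|ba].
        have : inverted (u k) b a by rewrite /inverted ba.
        rewrite iu => /andP[p le].
        have /inverted_pos : inverted (u k.+1) b a by rewrite iu p leqW.
        by rewrite /a /b !permK //; lia.
      have : inverted (u k.+1) a b by rewrite /inverted ab /a /b !permK.
      have : ~~ inverted (u k) a b by rewrite /inverted ab /= -leNgt ltW.
      by rewrite !iu; lia.
    move=> /(step _ lt1)[p e1] /(step _ lt2)[_ e2].
    by apply: (bij_inj (bu k.+1)); apply: (csb_strict cL p); rewrite e1 e2.
  - by rewrite -(prefix_oversize (leqnn _)) sM pre // uM.
  - rewrite (big_nth id) big_mkord sM -(uM M) //.
    have part k : (k <= M)%N -> len (u k) = (\sum_(i < k) len (nth id s i))%N.
      elim: k => [|k IH] kM; first by rewrite u0 affine_length_id big_ord0.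
      by rewrite big_ord_recr /= lenS nth_mkseq // IH // ltnW.
    exact: part.
  - move=> s' es; have := congr1 size es; rewrite sM size_rcons => Ms.
    have vid : v (size s') = id.
      have := nth_mkseq id v (n := M) (i := size s'); rewrite -/s es.
      by rewrite nth_rcons ltnn eqxx Ms => <-.
    have /Mmin : forall a b, (L a b <= size s')%N; last by rewrite Ms ltnn.
    move=> a b; case: (posnP (L a b)) => [->//|p].
    have : inverted (u M) a b by rewrite iu p maxM.
    by rewrite Ms uS vid iu => /andP[].
exists s => //.
have LE a b : value_label w (factor_label w s) a b = L a b.
  apply: eq_of_thresholds => k; rewrite -(factor_labelP aw fs) -iu.
  have [kM|Mk] := leqP k M; first by rewrite pre.
  by rewrite (prefix_full fs) ?uM ?sM // ltnW.
apply/funext => -[r a]; have := LE a (w r).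
by rewrite /L /value_label permK.
Qed.

(** * Exponents *)

Lemma expcmnE (k : nat) (e : monomial) d : expcmn e d k = (d * e k)%N.
Proof.
case: d => [|d]; first by rewrite /expcmn /= cm1.
rewrite /expcmn iteropS; elim: d => [|d IH]; first by rewrite mul1n.
by rewrite iterS mulcmE IH mulSn.
Qed.

Lemma factorization_monomialE s k : factorization_monomial n s k.+1 = len (nth id s k).
Proof.
rewrite /factorization_monomial.
rewrite (big_morph (fun e : monomial => e k.+1) (cmM k.+1) (cm1 k.+1)).
under eq_bigr do rewrite expcmnE ucmE eqSS.
have [lt|le] := ltnP k (size s).
  rewrite (bigD1 (Ordinal lt)) //= eqxx muln1 big1 ?addn0 // => i ne.
  rewrite (_ : (i == k :> nat) = false) ?muln0 //; apply/negbTE.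
  by apply: contraNneq ne => e; apply/eqP/val_inj.
rewrite big1 ?nth_default ?affine_length_id // => i _.
by rewrite (_ : (i == k :> nat) = false) ?muln0 //; have := ltn_ord i; lia.
Qed.

Lemma factorization_monomial0 s : factorization_monomial n s 0 = 0%N.
Proof.
rewrite /factorization_monomial.
rewrite (big_morph (fun e : monomial => e 0%N) (cmM 0%N) (cm1 0%N)).
by rewrite big1 // => i _; rewrite expcmnE ucmE muln0.
Qed.

Lemma diagram_rows_finite : finite_set (diagram_rows n w).
Proof.
have ephi := affine_pos_equivariant aw.
apply: (sub_finite_set _ (finite_image (fun p : int * int => (pos w p.2, p.1))
  (inversions_finite ephi aw))).
move=> [r a] [/(diagramE bw)/= ib /= wr]; exists (a, w r); last by rewrite /= permK.
by split; rewrite //= permK.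
Qed.

Lemma labelling_monomialE T k :
  labelling_monomial n w T k = count (fun b => T b == k) (fset_set (diagram_rows n w)).
Proof.
rewrite /labelling_monomial fsbig_finite; last exact: diagram_rows_finite.
rewrite (big_morph (fun e : monomial => e k) (cmM k) (cm1 k)) -sum1_count.
by rewrite [RHS]big_mkcond; apply: eq_bigr => b _; rewrite ucmE; case: eqP.
Qed.

(** Both exponents of x_(k+1) count inversions: the length of the factor is the number of
classes of inversions that it adds, and these are the boxes labelled k + 1. Choosing
representatives with the larger value in positions 1 to n matches the rows of the window. *)
Lemma labelling_monomial_factor s : cd_factorizations n w s ->
  labelling_monomial n w (factor_label w s) = factorization_monomial n s.
Proof.
move=> fs; apply/eqP/cmP => -[|k]; rewrite labelling_monomialE.
  rewrite factorization_monomial0; apply/eqP; rewrite -leqn0 leqNgt -has_count.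
  apply/hasPn => b; rewrite in_fset_set; last exact: diagram_rows_finite.
  move/set_mem => -[db _]; rewrite -lt0n.
  by have [[H _] _ _] := factor_label_csb aw fs; apply/H.
rewrite factorization_monomialE.
have ephi := affine_pos_equivariant aw; set phi := pos w in ephi.
set L := value_label w (factor_label w s).
have [K bound] := inverted_bound aw.
have suppL := csb_supp ((csb_labellingsE aw _ bound).1 (factor_label_csb aw fs)).2.
pose I k := fset_set (inversions m phi (prefix s k)).
pose B := fset_set (diagram_rows n w).
have lenI j : len (prefix s j) = size (I j).
  by rewrite (affine_lengthE ephi (prefix_affine fs j)).
have fI j := inversions_finite ephi (prefix_affine fs j).
have fB := diagram_rows_finite.
pose f (b : box) := (b.2, w b.1).
have perm : perm_eq (I k.+1) (I k ++ map f [seq b <- B | factor_label w s b == k.+1]).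
  apply: uniq_perm; first exact: fset_uniq.
    rewrite cat_uniq fset_uniq map_inj_in_uniq ?filter_uniq ?fset_uniq ?andbT //=.
      apply/hasPn => p /mapP[b]; rewrite mem_filter => /andP[/eqP e].
      rewrite in_fset_set // => /set_mem[/(diagramE bw) ib wb] ->.
      rewrite in_fset_set //; apply/negP => /set_mem[/= + _].
      rewrite (factor_labelP aw fs) /value_label permK //.
      by case: b e {ib wb} => r a /= ->; rewrite ltnn andbF.
    by move=> [r a] [r' a'] _ _ [-> /(bij_inj bw) ->].
  move=> [a b]; rewrite mem_cat !in_fset_set //.
  apply/idP/orP.
    move/set_mem => -[/=]; rewrite (factor_labelP aw fs) => /andP[l0 le] wb.
    move: le; rewrite leq_eqVlt ltnS => /orP[/eqP e|le]; [right|left].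
      apply/mapP; exists (pos w b, a); last by rewrite /f /= posK.
      rewrite mem_filter; apply/andP; split; first exact/eqP.
      rewrite in_fset_set //; apply/mem_set; split => //.
      by apply/(inverted_diagram bw); rewrite -suppL.
    by apply/mem_set; split; rewrite //= (factor_labelP aw fs) l0 le.
  case=> [/set_mem[/= ib wb]|].
    apply/mem_set; split=> //=; exact: (prefix_mono fs (leqnSn k)) ib.
  case/mapP => -[r q]; rewrite mem_filter => /andP[/eqP e].
  rewrite in_fset_set // => /set_mem[/= db wr] [-> ->].
  apply/mem_set; split; rewrite /= ?(factor_labelP aw fs) /phi ?permK //.
  by rewrite /value_label permK // e leqnn.
have := perm_size perm; rewrite size_cat size_map size_filter -!lenI.
by rewrite (prefix_lengthS fs) => /addnI e; apply/eqP; rewrite e.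
Qed.

End Bijection.

(** * Finiteness and the bijection *)

Lemma finite_seqs (X : Type) (V : set X) B : finite_set V ->
  finite_set [set s : seq X | (size s <= B)%N /\ all (fun x => `[< V x >]) s].
Proof.
move=> fV; elim: B => [|B IH].
  apply: (sub_finite_set _ (finite_set1 [::])) => -[|x s] // [].
  by rewrite ltn0.
apply: (sub_finite_set _ (_ : finite_set ([set [::]] `|`
  [set x.1 :: x.2 | x in V `*` [set s | (size s <= B)%N /\ all (fun x => `[< V x >]) s]]))).
  move=> [|x s]; first by left.
  by case=> /= le /andP[/asboolP Vx all_s]; right; exists (x, s).
rewrite finite_setU; split; first exact: finite_set1.
by apply: finite_image; exact: finite_setX.
Qed.

Section Finiteness.
Variables (m : nat) (w : int -> int).
Local Notation n := m.+2.
Hypothesis aw : affine_perm n w.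

(** The monomial bounds the number of factors, since the last one has positive length, and
the lengths of the factors; only finitely many words have bounded length. *)
Lemma factorizations_summable :
  summable (cd_factorizations n w) (factorization_monomial n).
Proof.
move=> e; pose B := (\sum_(k <- finsupp e) (k + e k))%N.
have supp k : e k != 0%N -> (k + e k <= B)%N.
  by rewrite -mem_finsupp => ke; rewrite /B (big_rem k ke) leq_addr.
pose W := [set a : seq 'Z_n | (size a <= B)%N /\ all (fun x => `[< setT x >]) a].
have fW : finite_set W by apply: finite_seqs; exact: finite_finset.
apply: (sub_finite_set _ (finite_seqs B (finite_image (@word_perm n) fW))).
move=> s [fs es]; have ek k : e k.+1 = affine_length n (nth id s k).
  by rewrite -es factorization_monomialE.
have word k : exists2 a : seq 'Z_n, word_perm a = nth id s k & size a = e k.+1.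
  have e0 : equivariant m id by [].
  have ak := factor_affine fs k.
  by have [a wa sa] := exists_word e0 ak; exists a => //; rewrite ek (affine_lengthE e0).
split.
  case: fs => _ _ _; case/lastP: s es ek word => // s v es ek word tr.
  have [a wa sa] := word (size s).
  have : e (size s).+1 != 0%N.
    rewrite -sa; case: a wa {sa} => // wa; exfalso; apply: (tr s).
    by move: wa; rewrite nth_rcons ltnn eqxx => <-.
  by move/supp; rewrite size_rcons; apply: leq_trans; exact: leq_addr.
apply/(all_nthP id) => k _; apply/asboolP; have [a wa sa] := word k; exists a => //.
split; last by apply/allP => x _; apply/asboolP.
rewrite sa; case: (eqVneq (e k.+1) 0%N) => [->//|/supp]; apply: leq_trans; exact: leq_addl.
Qed.

Lemma csb_fiberE e : fiber (csb_labellings n w) (labelling_monomial n w) e =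
  [set factor_label w s | s in fiber (cd_factorizations n w) (factorization_monomial n) e].
Proof.
apply/seteqP; split=> T.
  case=> csbT eT; have [s fs sT] := factor_label_surj aw csbT.
  by exists s => //; split=> //; rewrite -(labelling_monomial_factor aw fs) sT.
case=> s [fs es] <-; split; first exact: (factor_label_csb aw fs).
by rewrite (labelling_monomial_factor aw fs).
Qed.

End Finiteness.

Theorem theorem2p14 (n : nat) (w : int -> int) (hn : (2 <= n)%N)
    (hw : affine_perm n w) :
  [/\ summable (cd_factorizations n w) (factorization_monomial n),
      summable (csb_labellings n w) (labelling_monomial n w)
    & affine_stanley n w
      = monomial_sum (csb_labellings n w) (labelling_monomial n w)].
Proof.
case: n hn hw => [|[|m]] // _ aw.
have fin := @factorizations_summable m w.
split=> // [e|]; first by rewrite (csb_fiberE aw); apply: finite_image; exact: fin.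
apply/funext => e; rewrite /affine_stanley /monomial_sum (csb_fiberE aw).
congr Posz.
rewrite (@fset_set_image {classic seq (int -> int)} {classic box -> nat}); last exact: fin.
rewrite card_in_imfset //= => s s'.
rewrite !in_fset_set; [|exact: fin..].
by move=> /set_mem[fs _] /set_mem[fs' _]; exact: (factor_label_inj aw).
Qed.
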